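(* If $\Psi\subset L^2(\mathbb{R})^n$ is a semi-orthogonal wavelet then, for all $\alpha_0\in[-\pi,\pi)$, $$\limsup_{\xi\to\alpha_0}D_\Psi(\xi)\ge\operatorname{card}\{i\in\{1,\dots,n\}:\theta_i=\alpha_0\},$$ where $$D_\Psi(\xi)=\sum_{\psi\in\Psi}\sum_{m\ge1}\sum_{i=1}^n\sum_{k\in\mathbb{Z}}|\hat\psi_{\sigma^m(i)}|^2\big(N^m(\xi-\theta_i+2k\pi)\big),\quad\xi\in\mathbb{R}.$$ In particular, if there are two distinct indices $i\ne j$ with $\theta_i=\theta_j$, then there are no MRA wavelets (for the affine structure $(T,U)$ on $L^2(\mathbb{R})^n$).
   Context: Setting: fix integers $N\ge 2$, $n\ge 1$, a permutation $\sigma$ of $\{1,\dots,n\}$ and points $z_k=e^{-i\theta_k}$ with $\theta_k\in[-\pi,\pi)$ and $z_k^N=z_{\sigma(k)}$ for all $k\in\{1,\dots,n\}$. On $L^2(\mathbb{R})$ let $T_0f(x)=f(x-1)$ and $U_0f(x)=\frac1{\sqrt N}f(x/N)$. On $L^2(\mathbb{R})^n$ let $T(f_1,\dots,f_n)=(z_1T_0f_1,\dots,z_nT_0f_n)$ and $U(f_1,\dots,f_n)=(U_0f_{\sigma(1)},\dots,U_0f_{\sigma(n)})$. Fourier transform: $\hat f(\xi)=\int_{\mathbb{R}}f(x)e^{-i\xi x}\,dx$ (extended to $L^2(\mathbb{R})$ by density); $\hat\psi_i$ is the Fourier transform of the $i$-th component of $\psi\in L^2(\mathbb{R})^n$. A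 finite set $\Psi\subset L^2(\mathbb{R})^n$ is a semi-orthogonal wavelet if the affine system $\{U^jT^k\psi: j,k\in\mathbb{Z},\psi\in\Psi\}$ is a normalized tight frame for $L^2(\mathbb{R})^n$ (i.e. $\sum_{j,k,\psi}|\langle f\,|\,U^jT^k\psi\rangle|^2=\|f\|^2$ for all $f$) and $W_i\perp W_j$ for $i\ne j$, where $W_j=\overline{\operatorname{span}}\{U^{-j}T^k\psi: k\in\mathbb{Z},\psi\in\Psi\}$. The generalized multiresolution analysis (GMRA) associated to $\Psi$ is $V_j=\overline{\operatorname{span}}\{U^mT^k\psi: m>-j,k\in\mathbb{Z},\psi\in\Psi\}$, $j\in\mathbb{Z}$. A wavelet is a finite set $\Psi$ whose affine system is an orthonormal basis of $L^2(\mathbb{R})^n$. It is an MRA wavelet if its associated GMRA is an MRA, i.e. there is a vector $\varphi\in V_0$ such that $\{T^k\varphi: k\in\mathbb{Z}\}$ is an orthonormal basis of $V_0$. *)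

(* Defs.v *)
From HB Require Import structures.
From mathcomp Require Import all_boot all_order all_algebra all_fingroup.
From mathcomp Require Import complex.
From mathcomp Require Import all_classical all_reals all_analysis.

Set Implicit Arguments.
Unset Strict Implicit.
Unset Printing Implicit Defensive.

Import Order.TTheory GRing.Theory Num.Theory.
Import numFieldNormedType.Exports.
Import ComplexField.Normc.

Local Open Scope classical_set_scope.
Local Open Scope ring_scope.

(* Elements of L^2 are represented by functions: a vector of L^2(R)^n is a
   term of type [vec R n] satisfying [L2n], and equality in L^2(R)^n is
   [eqL2n], equality almost everywhere. *)

Section ComplexValued.
Variable R : realType.
Local Notation C := R[i].
Local Notation mu := (@lebesgue_measure R).
Implicit Types f g : R -> C.

Definition expi (t : R) : C := Complex (cos t) (sin t).

Definition cmeasurable f : Prop :=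
  measurable_fun setT (fun x => complex.Re (f x)) /\
  measurable_fun setT (fun x => complex.Im (f x)).

Definition cintegral f : C :=
  Complex (Rintegral mu setT (fun x => complex.Re (f x)))
          (Rintegral mu setT (fun x => complex.Im (f x))).

Definition sqnorm f : \bar R := (\int[mu]_x ((normc (f x)) ^+ 2)%:E)%E.

Definition L1 f : Prop :=
  cmeasurable f /\ ((\int[mu]_x (normc (f x))%:E)%E < +oo)%E.

Definition L2 f : Prop := cmeasurable f /\ (sqnorm f < +oo)%E.

Definition fourierL1 f : R -> C :=
  fun xi => cintegral (fun x => f x * expi (- (xi * x))).

(* [g] is (a representative of) the Fourier transform of [f], the transform
   on L^2 being the continuous extension of [fourierL1] from L^1 `&` L^2. *)
Definition is_fourier f g : Prop :=
  L2 f /\ L2 g /\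
  exists u : nat -> R -> C,
    (forall m, L1 (u m) /\ L2 (u m)) /\
    (fun m => sqnorm (fun x => u m x - f x)) @ \oo --> 0%E /\
    (fun m => sqnorm (fun xi => fourierL1 (u m) xi - g xi)) @ \oo --> 0%E.

Definition T0 f : R -> C := fun x => f (x - 1).
Definition T0inv f : R -> C := fun x => f (x + 1).

Definition U0 (N : nat) f : R -> C :=
  fun x => Complex (Num.sqrt N%:R)^-1 0 * f (x / N%:R).
Definition U0inv (N : nat) f : R -> C :=
  fun x => Complex (Num.sqrt N%:R) 0 * f (x * N%:R).

End ComplexValued.

Definition vec (R : realType) (n : nat) : Type := 'I_n -> R -> R[i].

Section Vectors.
Variables (R : realType) (n : nat).
Implicit Types (f g : vec R n) (S V : set (vec R n)).

Definition L2n : set (vec R n) := [set f | forall i, L2 (f i)].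

Definition eqL2n f g : Prop :=
  forall i, {ae @lebesgue_measure R, forall x, f i x = g i x}.

Definition inner f g : R[i] :=
  \sum_(i < n) cintegral (fun x => f i x * conjc (g i x)).

Definition sqnormn f : \bar R := (\sum_(i < n) sqnorm (f i))%E.

Definition closed_span S : set (vec R n) :=
  [set f | L2n f /\
    forall eps : R, 0 < eps ->
      exists (s : nat) (c : 'I_s -> R[i]) (v : 'I_s -> vec R n),
        (forall l, S (v l)) /\
        (sqnormn (fun i x => f i x - \sum_(l < s) c l * v l i x)%R
           < (eps ^+ 2)%:E)%E].

Definition orthonormal_basis (I : eqType) (e : I -> vec R n) V : Prop :=
  [/\ forall a, L2n (e a),
      forall a b, inner (e a) (e b) = (a == b)%:R
    & closed_span (range e) = V].

Definition normalized_tight_frame (I : choiceType) (e : I -> vec R n) : Prop :=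
  forall f, L2n f ->
    (\esum_(a in [set: I]) ((normc (inner f (e a))) ^+ 2)%:E = sqnormn f)%E.

Definition orthogonal V W : Prop :=
  forall f g, V f -> W g -> inner f g = 0.

End Vectors.

(* [zpow F G k] is F^k for k : int, where G is the inverse of F. *)
Definition zpow (A : Type) (F G : A -> A) (k : int) : A -> A :=
  match k with Posz m => iter m F | Negz m => iter m.+1 G end.

Section AffineStructure.
Variables (R : realType) (N n : nat) (sigma : {perm 'I_n}).
Variable theta : 'I_n -> R.

Definition zpt (k : 'I_n) : R[i] := expi (- theta k).

Definition opT (f : vec R n) : vec R n :=
  fun i x => zpt i * T0 (f i) x.
Definition opTinv (f : vec R n) : vec R n :=
  fun i x => (zpt i)^-1 * T0inv (f i) x.

Definition opU (f : vec R n) : vec R n := fun i => U0 N (f (sigma i)).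
Definition opUinv (f : vec R n) : vec R n :=
  fun i => U0inv N (f ((sigma^-1)%g i)).

Lemma expi_neq0 (t : R) : expi t != 0.
Proof.
apply/eqP => -[c0 s0]; have := cos2Dsin2 t.
by rewrite c0 s0 expr0n /= addr0 => /eqP; rewrite eq_sym oner_eq0.
Qed.

Lemma opTK : cancel opT opTinv.
Proof.
move=> f; apply/funext => i; apply/funext => x.
by rewrite /opTinv /opT /T0inv /T0 mulKf ?expi_neq0// addrK.
Qed.

Lemma opTinvK : cancel opTinv opT.
Proof.
move=> f; apply/funext => i; apply/funext => x.
by rewrite /opTinv /opT /T0inv /T0 mulVKf ?expi_neq0// subrK.
Qed.

Lemma opUK : (0 < N)%N -> cancel opU opUinv.
Proof.
move=> N0 f; apply/funext => i; apply/funext => x.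
have N0' : (N%:R : R) != 0 by rewrite pnatr_eq0 -lt0n.
have s0 : Num.sqrt (N%:R : R) != 0 by rewrite gt_eqF// sqrtr_gt0 ltr0n.
rewrite /opUinv /opU /U0inv /U0 permKV mulfK// mulrA.
have -> : Complex (Num.sqrt (N%:R : R)) 0 * Complex (Num.sqrt N%:R)^-1 0 = 1.
  by apply/eqP; rewrite eq_complex /= !(mulr0, mul0r) subr0 addr0 divff ?eqxx.
by rewrite mul1r.
Qed.

Lemma opUinvK : (0 < N)%N -> cancel opUinv opU.
Proof.
move=> N0 f; apply/funext => i; apply/funext => x.
have N0' : (N%:R : R) != 0 by rewrite pnatr_eq0 -lt0n.
have s0 : Num.sqrt (N%:R : R) != 0 by rewrite gt_eqF// sqrtr_gt0 ltr0n.
rewrite /opUinv /opU /U0inv /U0 permK divfK// mulrA.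
have -> : Complex (Num.sqrt (N%:R : R))^-1 0 * Complex (Num.sqrt N%:R) 0 = 1.
  by apply/eqP; rewrite eq_complex /= !(mulr0, mul0r) subr0 addr0 mulVf ?eqxx.
by rewrite mul1r.
Qed.

Definition Tpow : int -> vec R n -> vec R n := zpow opT opTinv.
Definition Upow : int -> vec R n -> vec R n := zpow opU opUinv.

(* A finite subset of L^2(R)^n is an enumeration Psi : 'I_r -> vec R n of its
   elements without repetition. *)
Definition finite_subset (r : nat) (Psi : 'I_r -> vec R n) : Prop :=
  (forall p, L2n (Psi p)) /\ (forall p q, eqL2n (Psi p) (Psi q) -> p = q).

Definition affine_system (r : nat) (Psi : 'I_r -> vec R n)
    (a : int * int * 'I_r) : vec R n :=
  let: (j, k, p) := a in Upow j (Tpow k (Psi p)).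

Definition spaceW (r : nat) (Psi : 'I_r -> vec R n) (j : int)
  : set (vec R n) :=
  closed_span [set v | exists k p, v = Upow (- j) (Tpow k (Psi p))].

Definition GMRA (r : nat) (Psi : 'I_r -> vec R n) (j : int)
  : set (vec R n) :=
  closed_span
    [set v | exists m k p, - j < m /\ v = Upow m (Tpow k (Psi p))].

Definition semi_orthogonal_wavelet (r : nat) (Psi : 'I_r -> vec R n) : Prop :=
  [/\ finite_subset Psi,
      normalized_tight_frame (affine_system Psi)
    & forall i j : int, i != j -> orthogonal (spaceW Psi i) (spaceW Psi j)].

Definition wavelet (r : nat) (Psi : 'I_r -> vec R n) : Prop :=
  finite_subset Psi /\ orthonormal_basis (affine_system Psi) (@L2n R n).

Definition is_MRA (V : int -> set (vec R n)) : Prop :=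
  exists phi, V 0 phi /\ orthonormal_basis (fun k : int => Tpow k phi) (V 0).

Definition MRA_wavelet (r : nat) (Psi : 'I_r -> vec R n) : Prop :=
  wavelet Psi /\ is_MRA (GMRA Psi).

(* [Psihat p i] stands for (a representative of) the Fourier transform of the
   i-th component of the p-th element of Psi. *)
Definition dimfun (r : nat) (Psihat : 'I_r -> vec R n) (xi : R) : \bar R :=
  (\sum_(p < r) \sum_(1 <= m <oo) \sum_(i < n) \esum_(k in [set: int])
    ((normc (Psihat p ((sigma ^+ m)%g i)
        (N%:R ^+ m * (xi - theta i + 2 * k%:~R * pi))) ^+ 2)%:E))%E.

End AffineStructure.

(* Main.v *)
(* The tight frame identity is tested on the unit vector whose only nonzero
   component, the i-th, is the inverse Fourier transform of the indicator
   function of [a, a + 2 pi[.  The levels [U^j] with j <= 0 contribute at most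
   the average over that interval of the Calderon sum
     sum_(l >= 0) sum_psi |psihat_(sigma^-l i)(xi / N^l)|^2,
   by Bessel's inequality for the exponentials e^(ik xi); the levels j >= 1
   contribute at most the energy of the Fourier transforms on the dilated
   intervals [a N^m, (a + 2 pi) N^m[, which tends to 0 as a tends to infinity.
   So the Calderon sum is, on average, at least almost 1 for every i.  To the
   right of alpha0, the terms k = 0 of [D] for the indices i with
   theta_i = alpha0 contain all the partial Calderon sums of these i, whence
   the lower bound for the limsup.

   If theta_i = theta_j with i <> j, let b_i and b_j be the indicator function
   of [0, 1[ placed in the components i and j.  When sigma^m = 1, [U^m b_i] and
   [U^m b_j] have the same coefficients with respect to the orthonormal orbits
   of b_i and b_j under [T], and they are close to V_0 for large m.  But the
   space generated by the orbit of a single vector phi cannot capture both: the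
   total energy of their projections on it is at most 1. *)
Require Import Defs.
From HB Require Import structures.
From mathcomp Require Import all_boot all_order all_algebra all_fingroup.
From mathcomp Require Import complex.
From mathcomp Require Import all_classical all_reals all_analysis.
From mathcomp Require Import measurable_realfun.
From mathcomp Require Import zify ring lra.
Import Order.TTheory GRing.Theory Num.Theory.
Import numFieldNormedType.Exports.
Import ComplexField.Normc.
Set Implicit Arguments.
Unset Strict Implicit.
Unset Printing Implicit Defensive.
Local Open Scope classical_set_scope.
Local Open Scope ring_scope.

(** * Complex-valued functions *)

Section ComplexNumbers.
Variable R : realType.
Local Notation C := R[i].
Implicit Types (x y : C) (a t : R).

(** For the first assertion the frame identity is the only source of a lower bound; everything else
    is an upper bound, so Bessel inequalities suffice and the Plancherel theorem is never invoked.
    Its substitute is the pairing of a function with translates of one explicit test function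
    ([ip_bump_fourier], by Fubini on L^1 and L^2, then by density), together with the explicit norm
    of that test function.

    The length 2 pi is the one on which the exponentials e^(ik xi) are orthogonal. Moved to the
    other side of the inner product, the level U^j multiplies the test interval by N^j. For j <= 0
    its length stays at most 2 pi and Bessel applies at once. For j >= 1 it is cut into N^j pieces,
    and the factor N^j lost to Cauchy-Schwarz is cancelled by the normalization of U.

    The test interval must be far from 0 while the limsup is local at alpha0. Dilation reconciles
    the two: a bound c for D on ]alpha0, alpha0 + e[ bounds the Calderon sums at every xi > 0,
    because xi / N^j falls into ]0, e[ for large j. *)

Lemma ReD x y : complex.Re (x + y) = complex.Re x + complex.Re y.
Proof. by case: x; case: y. Qed.
Lemma ImD x y : complex.Im (x + y) = complex.Im x + complex.Im y.
Proof. by case: x; case: y. Qed.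
Lemma ReM x y : complex.Re (x * y) =
  complex.Re x * complex.Re y - complex.Im x * complex.Im y.
Proof. by case: x; case: y. Qed.
Lemma ImM x y : complex.Im (x * y) =
  complex.Re x * complex.Im y + complex.Im x * complex.Re y.
Proof. by case: x => a b; case: y => c d. Qed.
Lemma Re_conj x : complex.Re (conjc x) = complex.Re x.
Proof. by case: x. Qed.
Lemma Im_conj x : complex.Im (conjc x) = - complex.Im x.
Proof. by case: x. Qed.

Lemma conjcD x y : conjc (x + y) = conjc x + conjc y.
Proof. exact: rmorphD. Qed.
Lemma conjcB x y : conjc (x - y) = conjc x - conjc y.
Proof. exact: rmorphB. Qed.
Lemma conjcM x y : conjc (x * y) = conjc x * conjc y.
Proof. exact: rmorphM. Qed.
Lemma conjc_sum (I : Type) (r : seq I) (F : I -> C) :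
  conjc (\sum_(i <- r) F i) = \sum_(i <- r) conjc (F i).
Proof. exact: rmorph_sum. Qed.

Lemma complex_eq x y :
  complex.Re x = complex.Re y -> complex.Im x = complex.Im y -> x = y.
Proof. by case: x => a b; case: y => c d /= -> ->. Qed.

Lemma normc_ge0 x : 0 <= normc x.
Proof. by case: x => a b; rewrite sqrtr_ge0. Qed.

Lemma sqr_normcE x : normc x ^+ 2 = complex.Re x ^+ 2 + complex.Im x ^+ 2.
Proof. by case: x => a b /=; rewrite sqr_sqrtr// addr_ge0// sqr_ge0. Qed.

Lemma mul_conjc x : x * conjc x = Complex (normc x ^+ 2) 0.
Proof.
rewrite sqr_normcE; case: x => a b; apply: complex_eq => /=; ring.
Qed.

Lemma normc_conj x : normc (conjc x) = normc x.
Proof. by case: x => a b /=; rewrite sqrrN. Qed.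

Lemma normc_real a : normc (Complex a 0) = `|a|.
Proof. by rewrite /= expr0n addr0 sqrtr_sqr. Qed.

Lemma ler_Re_normc x : `|complex.Re x| <= normc x.
Proof.
rewrite -[leLHS]ger0_norm// -ler_sqr ?nnegrE ?normc_ge0//.
by rewrite ger0_norm// sqr_normcE real_normK ?num_real// lerDl sqr_ge0.
Qed.

Lemma ler_Im_normc x : `|complex.Im x| <= normc x.
Proof.
rewrite -[leLHS]ger0_norm// -ler_sqr ?nnegrE ?normc_ge0//.
by rewrite ger0_norm// sqr_normcE real_normK ?num_real// lerDr sqr_ge0.
Qed.

Lemma normc_leD x y : normc (x + y) <= normc x + normc y.
Proof. exact: le_normcD. Qed.

Lemma sqr_normcD x y : normc (x + y) ^+ 2 <= 2 * normc x ^+ 2 + 2 * normc y ^+ 2.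
Proof.
apply: (@le_trans _ _ ((normc x + normc y) ^+ 2)).
  by rewrite ler_sqr ?nnegrE ?addr_ge0 ?normc_ge0// normc_leD.
rewrite -subr_ge0 [leRHS](_ : _ = (normc x - normc y) ^+ 2) ?sqr_ge0//; ring.
Qed.

Lemma expiD t a : expi (t + a) = expi t * expi a.
Proof. by rewrite /expi cosD sinD; apply: complex_eq => //=; rewrite addrC. Qed.

Lemma expi0 : expi 0 = 1 :> C.
Proof. by rewrite /expi cos0 sin0. Qed.

Lemma conjc_expi t : conjc (expi t) = expi (- t).
Proof. by rewrite /expi cosN sinN. Qed.

Lemma normc_expi t : normc (expi t) = 1.
Proof. by rewrite /expi /= cos2Dsin2 sqrtr1. Qed.

Lemma expiV t : (expi t)^-1 = expi (- t).
Proof.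
by apply: (mulfI (expi_neq0 t)); rewrite divff ?expi_neq0// -expiD subrr expi0.
Qed.

Lemma expi_2pi (k : int) : expi (2 * k%:~R * pi) = 1 :> C.
Proof.
have H (m : nat) : expi (2 * m%:R * pi) = 1 :> C.
  elim: m => [|m IH]; first by rewrite mulr0 mul0r expi0.
  have -> : 2 * m.+1%:R * pi = 2 * m%:R * pi + (0 + pi *+ 2) :> R.
    by rewrite -natr1; ring.
  by rewrite expiD IH mul1r /expi cosD2pi sinD2pi cos0 sin0.
case: k => m; first exact: H.
by rewrite NegzE mulrNz mulrN mulNr -expiV H invr1.
Qed.

End ComplexNumbers.

Section ComplexIntegral.
Variable R : realType.
Local Notation C := R[i].
Local Notation mu := (@lebesgue_measure R).
Implicit Types f g h : R -> C.

Lemma cmeasurableM f g : cmeasurable f -> cmeasurable g ->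
  cmeasurable (fun x => f x * g x).
Proof.
move=> [f1 f2] [g1 g2]; split.
  by under eq_fun do rewrite ReM; apply: measurable_funB; exact: measurable_funM.
by under eq_fun do rewrite ImM; apply: measurable_funD; exact: measurable_funM.
Qed.

Lemma cmeasurableD f g : cmeasurable f -> cmeasurable g ->
  cmeasurable (fun x => f x + g x).
Proof.
move=> [f1 f2] [g1 g2]; split.
  by under eq_fun do rewrite ReD; exact: measurable_funD.
by under eq_fun do rewrite ImD; exact: measurable_funD.
Qed.

Lemma cmeasurable_cst (c : C) : cmeasurable (fun=> c).
Proof. by split; exact: measurable_cst. Qed.

Lemma cmeasurable_conj f : cmeasurable f -> cmeasurable (fun x => conjc (f x)).
Proof.
move=> [f1 f2]; split; first by under eq_fun do rewrite Re_conj.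
by under eq_fun do rewrite Im_conj; exact: measurableT_comp.
Qed.

Lemma cmeasurable_comp (phi : R -> R) f : measurable_fun setT phi ->
  cmeasurable f -> cmeasurable (fun x => f (phi x)).
Proof. by move=> mp [f1 f2]; split; [exact: (measurableT_comp f1 mp)|exact: (measurableT_comp f2 mp)]. Qed.

Lemma cmeasurable_expi (phi : R -> R) : measurable_fun setT phi ->
  cmeasurable (fun x => expi (phi x)).
Proof.
move=> mp; split => /=; apply: measurableT_comp => //.
  by apply: continuous_measurable_fun; exact: continuous_cos.
by apply: continuous_measurable_fun; exact: continuous_sin.
Qed.

Lemma measurable_sqr_normc f : cmeasurable f ->
  measurable_fun setT (fun x => normc (f x) ^+ 2).
Proof.
move=> [f1 f2]; under eq_fun do rewrite sqr_normcE.
by apply: measurable_funD; exact: measurable_funX.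
Qed.

Lemma measurable_normc f : cmeasurable f ->
  measurable_fun setT (fun x => normc (f x)).
Proof.
move=> mf; rewrite (_ : (fun _ => _) = Num.sqrt \o (fun x => normc (f x) ^+ 2)).
  apply: measurableT_comp; last exact: measurable_sqr_normc.
  by apply: continuous_measurable_fun; exact: sqrt_continuous.
by apply/funext => x /=; rewrite sqrtr_sqr ger0_norm// normc_ge0.
Qed.

Lemma L1_le f (b : R -> R) : cmeasurable f -> measurable_fun setT b ->
  (forall x, normc (f x) <= b x) -> (\int[mu]_x (b x)%:E < +oo)%E -> L1 f.
Proof.
move=> mf mb fb; split => //; apply: le_lt_trans; last eassumption.
apply: ge0_le_integral => //.
- by move=> x _; rewrite lee_fin normc_ge0.
- by apply/measurable_EFinP; exact: measurable_normc.
- exact/measurable_EFinP.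
- by move=> x _; rewrite lee_fin.
Qed.

Lemma L1_integrable f : L1 f ->
  mu.-integrable setT (EFin \o (fun x => complex.Re (f x))) /\
  mu.-integrable setT (EFin \o (fun x => complex.Im (f x))).
Proof.
move=> [mf fi]; have [mr mi] := mf.
have ni : mu.-integrable setT (EFin \o (fun x => normc (f x))).
  apply/integrableP; split; first by apply/measurable_EFinP; exact: measurable_normc.
  by under eq_integral do rewrite /= ger0_norm ?normc_ge0//.
split; (apply: le_integrable ni => //; first exact/measurable_EFinP) => x _ /=;
  rewrite lee_fin [leRHS]ger0_norm ?normc_ge0//.
- exact: ler_Re_normc.
- exact: ler_Im_normc.
Qed.

Lemma cintegralD f g : L1 f -> L1 g ->
  cintegral (fun x => f x + g x) = cintegral f + cintegral g.
Proof.
move=> /L1_integrable[f1 f2] /L1_integrable[g1 g2]; apply: complex_eq => /=.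
  by under eq_Rintegral do rewrite ReD; rewrite RintegralD.
by under eq_Rintegral do rewrite ImD; rewrite RintegralD.
Qed.

Lemma L1Z (c : C) f : L1 f -> L1 (fun x => c * f x).
Proof.
move=> [mf fi]; split.
  by apply: cmeasurableM => //; exact: cmeasurable_cst.
under eq_integral do rewrite normcM EFinM.
rewrite ge0_integralZl//; last 3 first.
- by apply/measurable_EFinP; exact: measurable_normc.
- by move=> x _; rewrite lee_fin normc_ge0.
- by rewrite lee_fin normc_ge0.
by rewrite lte_mul_pinfty// lee_fin normc_ge0.
Qed.

Lemma cintegralZ (c : C) f : L1 f ->
  cintegral (fun x => c * f x) = c * cintegral f.
Proof.
move=> /L1_integrable[f1 f2].
have Z (a b : R) (u v : R -> R) :
  mu.-integrable setT (EFin \o u) -> mu.-integrable setT (EFin \o v) ->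
  \int[mu]_x (a * u x + b * v x) = a * \int[mu]_x u x + b * \int[mu]_x v x.
  move=> iu iv; rewrite RintegralD//; last 2 first.
  - exact: (integrableZl measurableT a iu).
  - exact: (integrableZl measurableT b iv).
  by rewrite !RintegralZl.
apply: complex_eq; rewrite /= ?ReM ?ImM /=.
  under eq_Rintegral do rewrite ReM -mulNr.
  by rewrite Z// mulNr.
under eq_Rintegral do rewrite ImM.
by rewrite Z.
Qed.

Lemma cintegral_conj f : L1 f ->
  cintegral (fun x => conjc (f x)) = conjc (cintegral f).
Proof.
move=> /L1_integrable[f1 f2]; apply: complex_eq; rewrite /= ?Re_conj ?Im_conj /=.
  by under eq_Rintegral do rewrite Re_conj.
under eq_Rintegral do rewrite Im_conj -mulN1r.
by rewrite RintegralZl// mulN1r.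
Qed.

Lemma cintegral0 : cintegral (fun=> 0) = 0 :> C.
Proof. by apply: complex_eq; rewrite /= /Rintegral integral0. Qed.

Lemma eq_cintegral f g : (forall x, f x = g x) -> cintegral f = cintegral g.
Proof. by move=> /funext ->. Qed.

End ComplexIntegral.

(** * Affine changes of variable in integrals *)

Section AffineChange.
Variable R : realType.
Local Notation mu := (@lebesgue_measure R).

(** The image of Lebesgue measure under x -> c x + d, multiplied by c, gives half-open intervals
    their length, so it is Lebesgue measure by uniqueness. The formula is then integration against
    an image measure. *)
Lemma ge0_integral_affine (c d : R) (f : R -> \bar R) :
  0 < c -> measurable_fun setT f -> (forall x, (0 <= f x)%E) ->
  (\int[mu]_x f (c * x + d)%R = c^-1%:E * \int[mu]_x f x)%E.
Proof.
move=> c0 mf f0.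
pose phi : R -> measurableTypeR R := fun x => c * x + d.
have mphi : measurable_fun setT phi.
  by apply: measurable_funD => //; exact: measurable_funM.
pose k : {nonneg R} := NngNum (ltW c0).
pose nu := mscale k (pushforward mu phi).
have mn : forall A, measurable A -> mu A = nu mphi A.
  apply: lebesgue_measure_unique => _ [[a b]] _ <-.
  rewrite /nu /mscale /pushforward /=.
  transitivity (c%:E * mu `]((a - d) / c)%R, ((b - d) / c)%R]%classic)%E; last first.
    congr (_ * mu _)%E; apply/seteqP; split => x /=; rewrite !in_itv/= /phi;
      by rewrite ltr_pdivrMr// ler_pdivlMr// ltrBlDr lerBrDr mulrC.
  rewrite !lebesgue_measure_itv/= !lte_fin ltr_pM2r ?invr_gt0// ltrD2r.
  case: ifPn => _; last by rewrite mule0.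
  by rewrite -!EFinD -EFinM; congr EFin; field; exact: lt0r_neq0.
have -> : (\int[mu]_x f x = \int[nu mphi]_x f x)%E.
  by apply: eq_measure_integral => A mA _; exact: mn.
rewrite ge0_integral_mscale//= ge0_integral_pushforward//.
by rewrite preimage_setT muleA -EFinM mulVf ?mul1e// lt0r_neq0.
Qed.

Lemma Rintegral_affine (c d : R) (f : R -> R) :
  0 < c -> mu.-integrable setT (EFin \o f) ->
  \int[mu]_x f (c * x + d) = c^-1 * \int[mu]_x f x.
Proof.
move=> c0 fi; have mf := measurable_int _ fi.
rewrite /Rintegral integralE.
under eq_integral do rewrite (funepos_comp (EFin \o f) (fun x => c * x + d)).
under [X in (_ - X)%E]eq_integral do
  rewrite (funeneg_comp (EFin \o f) (fun x => c * x + d)).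
rewrite (ge0_integral_affine _ c0)//; last exact: measurable_funepos.
rewrite (ge0_integral_affine _ c0)//; last exact: measurable_funeneg.
have /= fp := integrable_pos_fin_num measurableT fi.
have /= fn := integrable_neg_fin_num measurableT fi.
rewrite -muleBr//; last by rewrite fin_num_adde_defr.
by rewrite fineM//= ?[X in _ = _ * fine X]integralE// fin_numD fp fin_numN.
Qed.

Lemma cintegral_affine (c d : R) (f : R -> R[i]) : 0 < c -> L1 f ->
  cintegral (fun x => f (c * x + d)) = Complex c^-1 0 * cintegral f.
Proof.
move=> c0 /L1_integrable[f1 f2]; apply: complex_eq;
  rewrite /= ?mul0r ?subr0 ?addr0.
- exact: (Rintegral_affine d c0 f1).
- exact: (Rintegral_affine d c0 f2).
Qed.

Lemma measurable_affine (c d : R) : measurable_fun setT (fun x : R => c * x + d).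
Proof. by apply: measurable_funD => //; exact: measurable_funM. Qed.

Lemma cmeasurable_affine (c d : R) (f : R -> R[i]) : cmeasurable f ->
  cmeasurable (fun x => f (c * x + d)).
Proof. by apply: cmeasurable_comp; exact: measurable_affine. Qed.

Lemma measurable_esqr_normc (f : R -> R[i]) : cmeasurable f ->
  measurable_fun setT (fun x : R => ((normc (f x)) ^+ 2)%:E).
Proof. by move=> mf; apply/measurable_EFinP; exact: measurable_sqr_normc. Qed.

Lemma sqnorm_affine (c d : R) (f : R -> R[i]) : 0 < c -> cmeasurable f ->
  (sqnorm (fun x => f (c * x + d)%R) = c^-1%:E * sqnorm f)%E.
Proof.
move=> c0 mf.
apply: (ge0_integral_affine d c0 (measurable_esqr_normc mf)) => x.
by rewrite lee_fin sqr_ge0.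
Qed.

End AffineChange.

(** * Square-integrable functions of one variable *)

Section L2Theory.
Variable R : realType.
Local Notation C := R[i].
Local Notation mu := (@lebesgue_measure R).
Implicit Types f g h : R -> C.

Lemma sqnorm_ge0 f : (0 <= sqnorm f)%E.
Proof. by apply: integral_ge0 => x _; rewrite lee_fin sqr_ge0. Qed.

Lemma L2_le f (b : R -> R) : cmeasurable f -> measurable_fun setT b ->
  (forall x, normc (f x) ^+ 2 <= b x) -> (\int[mu]_x (b x)%:E < +oo)%E -> L2 f.
Proof.
move=> mf mb fb bi; split => //; apply: le_lt_trans bi.
apply: ge0_le_integral => //.
- by move=> x _; rewrite lee_fin sqr_ge0.
- exact: measurable_esqr_normc.
- by apply/measurable_EFinP.
- by move=> x _; rewrite lee_fin.
Qed.

Lemma L2_bounded_mul (k : R) f h : cmeasurable h ->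
  (forall x, normc (h x) <= k) -> L2 f -> L2 (fun x => h x * f x).
Proof.
move=> mh hk [mf fi]; apply: (@L2_le _ (fun x => k ^+ 2 * normc (f x) ^+ 2)).
- exact: cmeasurableM.
- by apply: measurable_funM => //; exact: measurable_sqr_normc.
- move=> x; rewrite normcM exprMn ler_wpM2r ?sqr_ge0// ler_sqr ?nnegrE ?normc_ge0//.
  exact: le_trans (normc_ge0 _) (hk x).
- under eq_integral do rewrite EFinM.
  rewrite ge0_integralZl_EFin//; last 3 first.
  + by move=> x _; rewrite lee_fin sqr_ge0.
  + exact: measurable_esqr_normc.
  + exact: sqr_ge0.
  by rewrite lte_mul_pinfty// ?lee_fin ?sqr_ge0.
Qed.

Lemma L2Z (c : C) f : L2 f -> L2 (fun x => c * f x).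
Proof. by apply: (L2_bounded_mul (k := normc c)) => //; exact: cmeasurable_cst. Qed.

Lemma sqnormD_lty f g : cmeasurable f -> cmeasurable g ->
  (sqnorm (fun x => f x + g x)%R <= 2%:E * sqnorm f + 2%:E * sqnorm g)%E.
Proof.
move=> mf mg; rewrite /sqnorm -!ge0_integralZl//; last 4 first.
- exact: measurable_esqr_normc.
- by move=> x _; rewrite lee_fin sqr_ge0.
- exact: measurable_esqr_normc.
- by move=> x _; rewrite lee_fin sqr_ge0.
rewrite -ge0_integralD//; last 4 first.
- by move=> x _; rewrite -EFinM lee_fin mulr_ge0 ?sqr_ge0.
- by apply: measurable_funeM; exact: measurable_esqr_normc.
- by move=> x _; rewrite -EFinM lee_fin mulr_ge0 ?sqr_ge0.
- by apply: measurable_funeM; exact: measurable_esqr_normc.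
apply: ge0_le_integral => //.
- by move=> x _; rewrite lee_fin sqr_ge0.
- by apply: measurable_esqr_normc; exact: cmeasurableD.
- by apply: emeasurable_funD; apply: measurable_funeM; exact: measurable_esqr_normc.
- by move=> x _; rewrite -!EFinM -EFinD lee_fin sqr_normcD.
Qed.

Lemma L2D f g : L2 f -> L2 g -> L2 (fun x => f x + g x).
Proof.
move=> [mf fi] [mg gi]; split; first exact: cmeasurableD.
apply: le_lt_trans (sqnormD_lty mf mg) _.
by rewrite lte_add_pinfty// lte_mul_pinfty// ?lee_fin.
Qed.

Lemma L2_0 : L2 (fun=> 0 : C).
Proof.
split; first exact: cmeasurable_cst.
rewrite /sqnorm; under eq_integral do rewrite normc0 expr0n/=.
by rewrite integral0.
Qed.

Lemma L2N f : L2 f -> L2 (fun x => - f x).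
Proof.
move=> /(L2Z (-1)) ; congr (L2 _).
by apply/funext => x; rewrite mulN1r.
Qed.

Lemma L2B f g : L2 f -> L2 g -> L2 (fun x => f x - g x).
Proof. by move=> Lf /L2N; exact: L2D. Qed.

Lemma L2_affine (c d : R) f : 0 < c -> L2 f -> L2 (fun x => f (c * x + d)).
Proof.
move=> c0 [mf fi]; split; first exact: cmeasurable_affine.
by rewrite sqnorm_affine// lte_mul_pinfty// lee_fin invr_ge0 ltW.
Qed.

Lemma L1M f g : L2 f -> L2 g -> L1 (fun x => f x * g x).
Proof.
move=> [mf fi] [mg gi].
apply: (@L1_le _ _ (fun x => normc (f x) ^+ 2 + normc (g x) ^+ 2)).
- exact: cmeasurableM.
- by apply: measurable_funD; exact: measurable_sqr_normc.
- move=> x; rewrite normcM.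
  have := normc_ge0 (f x); have := normc_ge0 (g x); nra.
- under eq_integral do rewrite EFinD.
  rewrite ge0_integralD//; last 4 first.
  + by move=> x _; rewrite lee_fin sqr_ge0.
  + exact: measurable_esqr_normc.
  + by move=> x _; rewrite lee_fin sqr_ge0.
  + exact: measurable_esqr_normc.
  exact: lte_add_pinfty.
Qed.

Lemma L2_conj f : L2 f -> L2 (fun x => conjc (f x)).
Proof.
move=> [mf fi]; split; first exact: cmeasurable_conj.
by rewrite /sqnorm; under eq_integral do rewrite normc_conj.
Qed.

End L2Theory.

Arguments cintegral : simpl never.

(** * Inner product on L^2(R)^n *)

Section InnerProduct.
Variables (R : realType) (n : nat).
Local Notation C := R[i].
Local Notation vec := (vec R n).
Implicit Types f g h : vec.

(** A real-valued squared norm, so that linear and ring arithmetic apply; [sqnormnE] identifies it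
    with the extended-real [sqnormn] on [L2n]. *)
Definition sqn f : R := complex.Re (inner f f).

Lemma L1_inner f g i : L2n f -> L2n g -> L1 (fun x => f i x * conjc (g i x)).
Proof. by move=> Lf Lg; apply: L1M => //; exact: L2_conj. Qed.

Lemma innerC f g : L2n f -> L2n g -> inner g f = conjc (inner f g).
Proof.
move=> Lf Lg; rewrite /inner conjc_sum; apply: eq_bigr => i _.
rewrite -[RHS]cintegral_conj; last exact: L1_inner.
by apply: eq_cintegral => x; rewrite conjcM conjcK mulrC.
Qed.

Lemma innerDl f g h : L2n f -> L2n g -> L2n h ->
  inner (fun i x => f i x + g i x) h = inner f h + inner g h.
Proof.
move=> Lf Lg Lh; rewrite /inner -big_split; apply: eq_bigr => i _ /=.
rewrite -cintegralD; [|exact: L1_inner|exact: L1_inner].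
by apply: eq_cintegral => x; rewrite mulrDl.
Qed.

Lemma innerZl (c : C) f h : L2n f -> L2n h ->
  inner (fun i x => c * f i x) h = c * inner f h.
Proof.
move=> Lf Lh; rewrite /inner mulr_sumr; apply: eq_bigr => i _ /=.
rewrite -cintegralZ; last exact: L1_inner.
by apply: eq_cintegral => x; rewrite mulrA.
Qed.

Lemma inner0l h : inner (fun _ _ => 0) h = 0.
Proof.
rewrite /inner big1// => i _.
by rewrite -[RHS](cintegral0 R); apply: eq_cintegral => x; rewrite mul0r.
Qed.

Lemma L2nD f g : L2n f -> L2n g -> L2n (fun i x => f i x + g i x).
Proof. by move=> Lf Lg i; exact: L2D. Qed.

Lemma L2nB f g : L2n f -> L2n g -> L2n (fun i x => f i x - g i x).
Proof. by move=> Lf Lg i; exact: L2B. Qed.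

Lemma L2nZ (c : C) f : L2n f -> L2n (fun i x => c * f i x).
Proof. by move=> Lf i; exact: L2Z. Qed.

Lemma innerBl f g h : L2n f -> L2n g -> L2n h ->
  inner (fun i x => f i x - g i x) h = inner f h - inner g h.
Proof.
move=> Lf Lg Lh; rewrite -mulN1r -innerZl// -innerDl//; last exact: L2nZ.
by congr inner; apply/funext => i; apply/funext => x; rewrite mulN1r.
Qed.

Lemma innerDr f g h : L2n f -> L2n g -> L2n h ->
  inner h (fun i x => f i x + g i x) = inner h f + inner h g.
Proof.
move=> Lf Lg Lh; rewrite innerC//; last exact: L2nD.
by rewrite innerDl// conjcD -!innerC.
Qed.

Lemma innerBr f g h : L2n f -> L2n g -> L2n h ->
  inner h (fun i x => f i x - g i x) = inner h f - inner h g.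
Proof.
move=> Lf Lg Lh; rewrite innerC//; last exact: L2nB.
by rewrite innerBl// conjcB -!innerC.
Qed.

Lemma innerZr (c : C) f h : L2n f -> L2n h ->
  inner h (fun i x => c * f i x) = conjc c * inner h f.
Proof.
move=> Lf Lh; rewrite innerC//; last exact: L2nZ.
by rewrite innerZl// conjcM -innerC.
Qed.

Section LinearCombination.
Variables (T : Type) (c : T -> C) (v : T -> vec).
Hypothesis Lv : forall k, L2n (v k).

Lemma L2n_lincomb (s : seq T) : L2n (fun i x => \sum_(k <- s) c k * v k i x).
Proof.
elim: s => [|k s IH] i.
  by under eq_fun do rewrite big_nil; exact: L2_0.
by under eq_fun do rewrite big_cons; apply: L2D (IH i); exact: (L2Z _ (Lv k i)).
Qed.

Lemma inner_lincombl (s : seq T) h : L2n h ->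
  inner (fun i x => \sum_(k <- s) c k * v k i x) h =
  \sum_(k <- s) c k * inner (v k) h.
Proof.
move=> Lh; elim: s => [|k s IH].
  rewrite big_nil -[RHS](inner0l h); congr inner.
  by apply/funext => i; apply/funext => x; rewrite big_nil.
rewrite big_cons -IH -innerZl// -innerDl//; [|exact: L2nZ|exact: L2n_lincomb].
by congr inner; apply/funext => i; apply/funext => x; rewrite big_cons.
Qed.

Lemma inner_lincombr (s : seq T) h : L2n h ->
  inner h (fun i x => \sum_(k <- s) c k * v k i x) =
  \sum_(k <- s) conjc (c k) * inner h (v k).
Proof.
move=> Lh; rewrite innerC//; last exact: L2n_lincomb.
rewrite inner_lincombl// conjc_sum; apply: eq_bigr => k _ /=.
by rewrite conjcM -innerC.
Qed.

End LinearCombination.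

Lemma sqnorm_inner (f : R -> C) : L2 f ->
  cintegral (fun x => f x * conjc (f x)) = Complex (fine (sqnorm f)) 0.
Proof.
move=> Lf; apply: complex_eq; rewrite /cintegral /= /Rintegral.
  by congr fine; apply: eq_integral => x _; rewrite mul_conjc.
by rewrite integral0_eq// => x _; rewrite mul_conjc.
Qed.

Lemma inner_self f : L2n f -> inner f f = Complex (sqn f) 0.
Proof.
move=> Lf; apply: complex_eq => //=.
rewrite /inner (eq_bigr (fun i => Complex (fine (sqnorm (f i))) 0)); last first.
  by move=> i _; exact: sqnorm_inner.
by elim/big_ind : _ => // x y; rewrite ImD => -> ->; rewrite addr0.
Qed.

Lemma sqnormnE f : L2n f -> sqnormn f = (sqn f)%:E.
Proof.
move=> Lf; rewrite /sqnormn /sqn /inner.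
rewrite (eq_bigr (fun i => (fine (sqnorm (f i)))%:E)); last first.
  move=> i _; rewrite fineK// ge0_fin_numE; last exact: sqnorm_ge0.
  by case: (Lf i).
rewrite sumEFin; congr EFin.
elim/big_rec2 : _ => // i x y _; rewrite ReD => <-.
by rewrite sqnorm_inner.
Qed.

Lemma sqn_ge0 f : L2n f -> 0 <= sqn f.
Proof.
move=> Lf; rewrite -lee_fin -sqnormnE//.
by apply: sume_ge0 => i _; exact: sqnorm_ge0.
Qed.

(** Completing the square in each coefficient. The identity serves three times: with the Fourier
    coefficients for c it gives Bessel, with f = 0 the norm of a combination, and with the last sum
    dropped a lower bound for the energy of f near a span. *)
Lemma sqn_dist_lincomb (T : eqType) (s : seq T) (c : T -> C) (e : T -> vec) f :
  L2n f -> (forall k, L2n (e k)) -> uniq s ->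
  {in s &, forall a b, inner (e a) (e b) = (a == b)%:R} ->
  sqn (fun i x => f i x - \sum_(k <- s) c k * e k i x) =
  sqn f - \sum_(k <- s) normc (inner f (e k)) ^+ 2
  + \sum_(k <- s) normc (inner f (e k) - c k) ^+ 2.
Proof.
move=> Lf Le us oe; have Lq := L2n_lincomb c Le s; rewrite /sqn.
rewrite innerBl//; last exact: L2nB.
rewrite !innerBr// [X in _ - (_ - X)]inner_lincombl//.
have -> : \sum_(k <- s) c k * inner (e k)
    (fun i x => \sum_(k <- s) c k * e k i x) = \sum_(k <- s) c k * conjc (c k).
  apply: eq_big_seq => k ks; rewrite inner_lincombr//.
  rewrite (bigD1_seq k)//= oe// eqxx mulr1 big_seq_cond big1 ?addr0// => l.
  by rewrite andbC => /andP[lk ls]; rewrite oe// eq_sym (negbTE lk) mulr0.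
rewrite inner_lincombl// inner_lincombr//.
have ReB (x y : C) : complex.Re (x - y) = complex.Re x - complex.Re y.
  by case: x; case: y.
have Re_sum (F : T -> C) :
    complex.Re (\sum_(k <- s) F k) = \sum_(k <- s) complex.Re (F k).
  by elim/big_rec2 : _ => // i x y _ <-; rewrite ReD.
rewrite !ReB !Re_sum -addrA -[in RHS]addrA; congr (_ + _).
rewrite opprB -!sumrN -!big_split /=.
apply: eq_bigr => k _; rewrite (innerC Lf (Le k)).
by case: (inner f (e k)) (c k) => a b [a' b'];
  rewrite !sqr_normcE /=; ring.
Qed.

Lemma bessel (T : eqType) (s : seq T) (e : T -> vec) f :
  L2n f -> (forall k, L2n (e k)) -> uniq s ->
  {in s &, forall a b, inner (e a) (e b) = (a == b)%:R} ->
  \sum_(k <- s) normc (inner f (e k)) ^+ 2 <= sqn f.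
Proof.
move=> Lf Le us oe.
have := sqn_dist_lincomb (fun k => inner f (e k)) Lf Le us oe.
rewrite [X in _ = _ + X]big1; last first.
  by move=> k _; rewrite subrr normc0 expr0n.
move=> E; rewrite -subr_ge0 -[leRHS]addr0 -E.
by apply: sqn_ge0; apply: L2nB => //; exact: L2n_lincomb.
Qed.

(** The parallelogram law with the term of f - g dropped. *)
Lemma sqnD_le f g : L2n f -> L2n g ->
  sqn (fun i x => f i x + g i x) <= 2 * sqn f + 2 * sqn g.
Proof.
move=> Lf Lg; have := sqn_ge0 (L2nB Lf Lg).
rewrite /sqn innerBl//; last exact: L2nB.
rewrite innerDl//; last exact: L2nD.
rewrite !innerBr// !innerDr//.
case: (inner f f) => a a'; case: (inner f g) => b b'.
case: (inner g f) => c c'; case: (inner g g) => d d' /=; lra.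
Qed.

Lemma cauchy_schwarz f g : L2n f -> L2n g ->
  normc (inner f g) ^+ 2 <= sqn f * sqn g.
Proof.
move=> Lf Lg.
(* The expansion of the squared norm of f - t <f, g> g for real t; multiplying t by <f, g> makes the
   cross terms real. *)
have key (t : R) : 0 <= sqn f - 2 * t * normc (inner f g) ^+ 2
    + t ^+ 2 * normc (inner f g) ^+ 2 * sqn g.
  have := sqn_ge0 (L2nB Lf (L2nZ (Complex t 0 * inner f g) Lg)).
  have Lz := L2nZ (Complex t 0 * inner f g) Lg.
  rewrite {1}/sqn innerBl//; last exact: L2nB.
  rewrite !innerBr// innerZr// innerZl// innerZl// innerZr// (innerC Lf Lg).
  rewrite (inner_self Lf) (inner_self Lg).
  case: (inner f g) => a b; rewrite !sqr_normcE /=.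
  by move=> /le_trans; apply; rewrite le_eqVlt; apply/orP; left; apply/eqP; ring.
have p0 : 0 <= normc (inner f g) ^+ 2 by exact: sqr_ge0.
move: (normc _ ^+ 2) p0 key => p p0 key.
have := sqn_ge0 Lg; rewrite le_eqVlt => /predU1P[g0|g0].
  move: p0; rewrite -g0 mulr0 le_eqVlt => /predU1P[<-//|p0].
  (* When g has norm 0 the expression is affine in t, and this t makes it equal to -1. *)
  have := key ((sqn f + 1) / (2 * p)).
  rewrite -g0 mulr0 addr0.
  rewrite (_ : _ - _ = - 1) ?oppr_ge0 ?ler10//.
  by field; exact: lt0r_neq0.
have := key (sqn g)^-1.
rewrite (_ : _ + _ = sqn f - p / sqn g).
  by rewrite subr_ge0 ler_pdivrMr.
by field; exact: lt0r_neq0.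
Qed.

End InnerProduct.

(** * The affine operators *)

Section AffineOperators.
Variables (R : realType) (N n : nat) (sigma : {perm 'I_n}).
Variable theta : 'I_n -> R.
Hypothesis N_gt0 : (0 < N)%N.
Local Notation C := R[i].
Local Notation vec := (vec R n).
Implicit Types f g h : vec.

(** Covers both operators: c = k = 1 for T, up to its phase, and c = 1 / N with k = 1 / sqrt N for
    U. *)
Lemma cintegral_dilation (k c d : R) (u v : R -> C) :
  0 < c -> k ^+ 2 = c -> L2 u -> L2 v ->
  cintegral (fun x => (Complex k 0 * u (c * x + d)) *
    conjc (Complex k 0 * v (c * x + d))) =
  cintegral (fun x => u x * conjc (v x)).
Proof.
move=> c0 kc Lu Lv.
have L1uv : L1 (fun x => u x * conjc (v x)) by apply: L1M => //; exact: L2_conj.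
have L1uv' : L1 (fun x => u (c * x + d) * conjc (v (c * x + d))).
  by apply: L1M; [|apply: L2_conj]; exact: L2_affine.
rewrite (@eq_cintegral _ _ (fun x => Complex c 0 *
   (u (c * x + d) * conjc (v (c * x + d))))); last first.
  move=> x; rewrite conjcM mulrACA; congr (_ * _).
  by rewrite -kc; apply: complex_eq => /=; ring.
rewrite cintegralZ// (cintegral_affine d c0 L1uv) mulrA.
rewrite [X in X * _](_ : _ = 1) ?mul1r//; apply: complex_eq => /=.
  by rewrite mulr0 subr0 divff// lt0r_neq0.
by rewrite mulr0 mul0r addr0.
Qed.

Lemma opTE f i : opT theta f i = fun x => zpt theta i * f i (1 * x + (- 1)).
Proof. by apply/funext => x; rewrite /opT /T0 mul1r. Qed.

Lemma opTinvE f i :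
  opTinv theta f i = fun x => (zpt theta i)^-1 * f i (1 * x + 1).
Proof. by apply/funext => x; rewrite /opTinv /T0inv mul1r. Qed.

Lemma opUE f i : opU N sigma f i =
  fun x => Complex (Num.sqrt N%:R)^-1 0 * f (sigma i) (N%:R^-1 * x + 0).
Proof. by apply/funext => x; rewrite /opU /U0 addr0 mulrC [_ * x]mulrC mulrC. Qed.

Lemma opUinvE f i : opUinv N sigma f i =
  fun x => Complex (Num.sqrt N%:R) 0 * f ((sigma^-1)%g i) (N%:R * x + 0).
Proof. by apply/funext => x; rewrite /opUinv /U0inv addr0 [_ * x]mulrC. Qed.

Let N0 : 0 < N%:R :> R. Proof. by rewrite ltr0n. Qed.

Lemma L2n_opT f : L2n f -> L2n (opT theta f).
Proof. by move=> Lf i; rewrite opTE; apply: L2Z; apply: L2_affine. Qed.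

Lemma L2n_opTinv f : L2n f -> L2n (opTinv theta f).
Proof. by move=> Lf i; rewrite opTinvE; apply: L2Z; apply: L2_affine. Qed.

Lemma L2n_opU f : L2n f -> L2n (opU N sigma f).
Proof.
by move=> Lf i; rewrite opUE; apply: L2Z; apply: L2_affine; rewrite ?invr_gt0.
Qed.

Lemma L2n_opUinv f : L2n f -> L2n (opUinv N sigma f).
Proof. by move=> Lf i; rewrite opUinvE; apply: L2Z; apply: L2_affine. Qed.

Lemma inner_opU f g : L2n f -> L2n g ->
  inner (opU N sigma f) (opU N sigma g) = inner f g.
Proof.
move=> Lf Lg; rewrite /inner [RHS](reindex_inj (@perm_inj _ sigma)).
apply: eq_bigr => i _; rewrite !opUE cintegral_dilation// ?invr_gt0//.
by rewrite exprVn sqr_sqrtr// ltW.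
Qed.

Lemma inner_opUinv f g : L2n f -> L2n g ->
  inner (opUinv N sigma f) (opUinv N sigma g) = inner f g.
Proof.
move=> Lf Lg.
by rewrite -inner_opU ?opUinvK//; exact: L2n_opUinv.
Qed.

Lemma mul_zpt_conj i : zpt theta i * conjc (zpt theta i) = 1.
Proof. by rewrite /zpt conjc_expi -expiD subrr expi0. Qed.

Lemma inner_opT f g : L2n f -> L2n g ->
  inner (opT theta f) (opT theta g) = inner f g.
Proof.
move=> Lf Lg; apply: eq_bigr => i _; rewrite !opTE.
rewrite -(cintegral_dilation (k := 1) (c := 1) (- 1) _ _ (Lf i) (Lg i))//;
  last by rewrite expr1n.
apply: eq_cintegral => x.
by rewrite !conjcM mulrACA mul_zpt_conj !mul1r conjc1 mul1r.
Qed.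

Lemma inner_opTinv f g : L2n f -> L2n g ->
  inner (opTinv theta f) (opTinv theta g) = inner f g.
Proof.
move=> Lf Lg.
by rewrite -inner_opT ?opTinvK//; exact: L2n_opTinv.
Qed.

Section Zpow.
Variables F G : vec -> vec.
Hypothesis LF : forall f, L2n f -> L2n (F f).
Hypothesis LG : forall f, L2n f -> L2n (G f).
Hypothesis iF : forall f g, L2n f -> L2n g -> inner (F f) (F g) = inner f g.
Hypothesis iG : forall f g, L2n f -> L2n g -> inner (G f) (G g) = inner f g.

Lemma L2n_iter m f : L2n f -> L2n (iter m F f).
Proof. by move=> Lf; elim: m => // m IH; rewrite iterS; exact: LF. Qed.

Lemma inner_iter m f g : L2n f -> L2n g ->
  inner (iter m F f) (iter m F g) = inner f g.
Proof.
move=> Lf Lg; elim: m => // m IH.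
by rewrite !iterS iF//; exact: L2n_iter.
Qed.

End Zpow.

Lemma L2n_zpow (F G : vec -> vec) (k : int) f :
  (forall f, L2n f -> L2n (F f)) -> (forall f, L2n f -> L2n (G f)) ->
  L2n f -> L2n (zpow F G k f).
Proof. by move=> LF LG Lf; case: k => m; exact: L2n_iter. Qed.

Lemma inner_zpow (F G : vec -> vec) (k : int) f g :
  (forall f, L2n f -> L2n (F f)) -> (forall f, L2n f -> L2n (G f)) ->
  (forall f g, L2n f -> L2n g -> inner (F f) (F g) = inner f g) ->
  (forall f g, L2n f -> L2n g -> inner (G f) (G g) = inner f g) ->
  L2n f -> L2n g -> inner (zpow F G k f) (zpow F G k g) = inner f g.
Proof. by move=> LF LG iF iG Lf Lg; case: k => m; exact: inner_iter. Qed.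

Lemma L2n_Tpow k f : L2n f -> L2n (Tpow theta k f).
Proof. by apply: L2n_zpow; [exact: L2n_opT|exact: L2n_opTinv]. Qed.

Lemma L2n_Upow k f : L2n f -> L2n (Upow N sigma k f).
Proof. by apply: L2n_zpow; [exact: L2n_opU|exact: L2n_opUinv]. Qed.

Lemma inner_Tpow k f g : L2n f -> L2n g ->
  inner (Tpow theta k f) (Tpow theta k g) = inner f g.
Proof.
by apply: inner_zpow; [exact: L2n_opT|exact: L2n_opTinv|exact: inner_opT
  |exact: inner_opTinv].
Qed.

Lemma TpowE (k : int) f i x :
  Tpow theta k f i x = expi (- (k%:~R * theta i)) * f i (x - k%:~R).
Proof.
rewrite /Tpow; case: k => m /=.
  elim: m x => [|m IH] x; first by rewrite mulr0z mul0r oppr0 expi0 mul1r addr0.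
  rewrite iterS /opT /T0 IH mulrA -expiD; congr (expi _ * f i _).
    by rewrite -[in RHS]pmulrn -natr1 pmulrn; ring.
  by rewrite -[in RHS]pmulrn -natr1 pmulrn; ring.
elim: m x => [|m IH] x.
  rewrite /= /opTinv /T0inv /zpt expiV; congr (expi _ * f i _).
    by rewrite mulN1r.
  by rewrite opprK.
transitivity ((zpt theta i)^-1 * opTinv theta (iter m (opTinv theta) f) i (x + 1)).
  by [].
rewrite IH /zpt expiV mulrA -expiD.
rewrite !NegzE !mulrNz -!pmulrn -[in RHS]natr1; congr (expi _ * f i _); ring.
Qed.

Lemma TpowD k l f : Tpow theta (k + l) f = Tpow theta k (Tpow theta l f).
Proof.
apply/funext => i; apply/funext => x; rewrite !TpowE mulrA -expiD intrD.
by congr (expi _ * f i _); ring.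
Qed.

Lemma Tpow0 f : Tpow theta 0 f = f.
Proof. by []. Qed.

Lemma inner_Tpow_shift k l f g : L2n f -> L2n g ->
  inner (Tpow theta k f) (Tpow theta l g) = inner f (Tpow theta (l - k) g).
Proof.
move=> Lf Lg; rewrite -[RHS](inner_Tpow k)//; last exact: L2n_Tpow.
by rewrite -TpowD addrC subrK.
Qed.

Lemma iter_opUE m f i x : iter m (opU N sigma) f i x =
  Complex ((Num.sqrt N%:R)^-1 ^+ m) 0 * f ((sigma ^+ m)%g i) (x / N%:R ^+ m).
Proof.
elim: m i x => [|m IH] i x.
  by rewrite expr0 mul1r expg0 perm1 expr0 divr1.
rewrite iterS /opU /U0 IH mulrA; congr (_ * f _ _).
- by rewrite exprS; apply: complex_eq => /=; ring.
- by rewrite expgS permM.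
- by rewrite exprS invfM mulrA.
Qed.

Lemma iter_opUinvE m f i x : iter m (opUinv N sigma) f i x =
  Complex (Num.sqrt N%:R ^+ m) 0 * f ((sigma^-1 ^+ m)%g i) (x * N%:R ^+ m).
Proof.
elim: m i x => [|m IH] i x.
  by rewrite expr0 mul1r expg0 perm1 expr0 mulr1.
rewrite iterS /opUinv /U0inv IH mulrA; congr (_ * f _ _).
- by rewrite exprS; apply: complex_eq => /=; ring.
- by rewrite expgS permM.
- by rewrite exprS mulrA.
Qed.

Lemma iter_opUK m : cancel (iter m (opU N sigma)) (iter m (@opUinv R N n sigma)).
Proof.
by elim: m => // m IH f; rewrite iterSr [X in iter _ _ (_ X)]iterS opUK.
Qed.

Lemma iter_opUinvK m :
  cancel (iter m (opUinv N sigma)) (iter m (@opU R N n sigma)).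
Proof.
by elim: m => // m IH f; rewrite iterSr [X in iter _ _ (_ X)]iterS opUinvK.
Qed.

(** Used to push finitely many levels of the affine system above 0, hence into V_0, by one large
    power of U. *)
Lemma UpowD_nat (m : nat) (k : int) f : 0 <= m%:Z + k ->
  iter m (opU N sigma) (Upow N sigma k f) = Upow N sigma (m%:Z + k) f.
Proof.
case: k => [k|k]; first by rewrite /Upow/= -iterD.
rewrite /Upow NegzE => mk.
have km : (k.+1 <= m)%N by rewrite -lez_nat -subr_ge0.
rewrite -[m in iter m](subnK km) iterD -[zpow _ _ _ _]/(iter k.+1 _ f).
by rewrite iter_opUinvK subzn.
Qed.

End AffineOperators.

(** * Repeated characters exclude MRA wavelets *)

Section Windows.
Variable R : realType.
Local Notation C := R[i].
Local Notation mu := (@lebesgue_measure R).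
Implicit Types a b x : R.

(** Half-open intervals make adjacent windows add up pointwise, at the end points too; [box_sum] and
    [winD] rely on it. *)
Definition win a b x : C := if a <= x < b then 1 else 0.

Lemma winE a b x : win a b x = Complex (\1_(`[a, b[%classic) x) 0.
Proof.
rewrite /win indicE; case: ifPn => xab.
  by rewrite mem_set//= in_itv.
by rewrite memNset//= in_itv/=; exact/negP.
Qed.

Lemma cmeasurable_win a b : cmeasurable (win a b).
Proof.
rewrite (_ : win a b = fun x => Complex (\1_(`[a, b[%classic) x) 0); last first.
  by apply/funext => x; exact: winE.
by split => /=; [exact: measurable_indic|exact: measurable_cst].
Qed.

Lemma normc_win a b x : normc (win a b x) = \1_(`[a, b[%classic) x.
Proof. by rewrite winE normc_real ger0_norm. Qed.

Lemma sqr_normc_win a b x : normc (win a b x) ^+ 2 = \1_(`[a, b[%classic) x.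
Proof. by rewrite normc_win indicE; case: (_ \in _); rewrite ?expr1n ?expr0n. Qed.

Lemma integral_win a b : a <= b ->
  (\int[mu]_x (\1_(`[a, b[%classic) x)%:E = (b - a)%:E)%E.
Proof.
move=> ab; rewrite integral_indic// setIT/= lebesgue_measure_itv/= lte_fin.
case: ltP => // ba; have -> : a = b by apply: le_anti; rewrite ab.
by rewrite subrr.
Qed.

Lemma sqnorm_win a b : a <= b -> sqnorm (win a b) = (b - a)%:E.
Proof.
by move=> ab; rewrite /sqnorm; under eq_integral do rewrite sqr_normc_win;
  exact: integral_win.
Qed.

Lemma L2_win a b : L2 (win a b).
Proof.
split; first exact: cmeasurable_win.
have [ab|/ltW ba] := leP a b; first by rewrite sqnorm_win// ltry.
rewrite /sqnorm integral0_eq ?ltry// => x _.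
rewrite /win; case: ifPn; last by rewrite normc0 expr0n.
by move=> /andP[/le_lt_trans/[apply]]; rewrite ltNge ba.
Qed.

Lemma conjc_win a b x : conjc (win a b x) = win a b x.
Proof. by rewrite winE /= oppr0. Qed.

Lemma winM a b x : win a b x * win a b x = win a b x.
Proof. by rewrite /win; case: ifP; rewrite ?mulr1 ?mulr0. Qed.

End Windows.

Section BoxFunctions.
Variables (R : realType) (n : nat).
Local Notation C := R[i].
Local Notation mu := (@lebesgue_measure R).

Definition single (i0 : 'I_n) (u : R -> C) : vec R n :=
  fun i x => if i == i0 then u x else 0.

Definition box : R -> C := win 0 1.

Lemma L2n_single i0 u : L2 u -> L2n (single i0 u).
Proof. by move=> Lu i; rewrite /single; case: eqP => _ //; exact: L2_0. Qed.

Lemma inner_single i0 u v : L2 u -> L2 v ->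
  inner (single i0 u) (single i0 v) = cintegral (fun x => u x * conjc (v x)).
Proof.
move=> Lu Lv; rewrite /inner (bigD1 i0)//= big1 ?addr0.
  by apply: eq_cintegral => x; rewrite /single eqxx.
move=> i /negbTE ii0; rewrite -[RHS](cintegral0 R); apply: eq_cintegral => x.
by rewrite /single ii0 mul0r.
Qed.

Lemma inner_single_neq i0 i1 u v : i0 != i1 ->
  inner (single i0 u) (single i1 v) = 0.
Proof.
move=> i01; rewrite /inner big1// => i _; rewrite -[RHS](cintegral0 R).
apply: eq_cintegral => x; rewrite /single.
case: (eqVneq i i0) => [->|_]; last by rewrite mul0r.
by rewrite (negbTE i01) conjc0 mulr0.
Qed.

Lemma sqnorm_box : sqnorm box = 1%E.
Proof. by rewrite /box sqnorm_win// subr0. Qed.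

Lemma L2_box : L2 box.
Proof. exact: L2_win. Qed.

Lemma box_sum (M : nat) x :
  \sum_(0 <= r < M) box (x - r%:R) = if 0 <= x < M%:R then 1 else 0.
Proof.
elim: M => [|M IH].
  by rewrite big_geq//; case: ifPn => // /andP[/le_lt_trans/[apply]]; rewrite ltxx.
rewrite big_nat_recr//= IH /box /win -natr1 subr_ge0 ltrBlDl.
have M0 : 0 <= M%:R :> R by [].
case: (ltP x M%:R) => xM.
  rewrite /= addr0 !andbT; congr (if _ then _ else _).
  by rewrite (lt_trans xM) ?andbT// ltrDl.
by rewrite andbF add0r (le_trans M0 xM).
Qed.

End BoxFunctions.

(** * Two orbits with the same character against one cyclic generator *)

Section NoMRA.
Variables (R : realType) (N n : nat) (sigma : {perm 'I_n}).
Variable theta : 'I_n -> R.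
Hypothesis N_gt0 : (0 < N)%N.
Local Notation C := R[i].
Local Notation T := (Tpow theta).
Local Notation bx i := (single i (@box R)).
Implicit Types (i : 'I_n) (f g phi : vec R n).

Lemma L2n_bx i : L2n (bx i).
Proof. exact: L2n_single (L2_box R). Qed.

Lemma Tpow_bx_orthonormal (a b : 'I_n * int) :
  inner (T a.2 (bx a.1)) (T b.2 (bx b.1)) = (a == b)%:R.
Proof.
case: a b => [i k] [j l] /=.
rewrite (inner_Tpow_shift theta k l (L2n_bx i) (L2n_bx j)) xpair_eqE.
have -> : T (l - k) (bx j) = single j
    (fun x => expi (- ((l - k)%:~R * theta j)) * box (x - (l - k)%:~R)).
  apply/funext => i'; apply/funext => x; rewrite TpowE /single.
  by case: eqP => [->//|_]; rewrite mulr0.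
have [<-|ij] := eqVneq i j; last by rewrite inner_single_neq.
have Lb : L2 (fun x => expi (- ((l - k)%:~R * theta i)) * box (x - (l - k)%:~R)).
  apply: L2Z; rewrite (_ : (fun _ => _) = fun x => box (1 * x + - (l - k)%:~R)).
    by apply: L2_affine => //; exact: L2_box.
  by apply/funext => x; rewrite mul1r.
rewrite inner_single//; last exact: L2_box.
have [->|kl] := eqVneq k l; rewrite /=.
  under eq_cintegral do rewrite subrr mulr0z mul0r oppr0 expi0 mul1r addr0.
  by rewrite sqnorm_inner ?sqnorm_box//; exact: L2_box.
rewrite -[RHS](cintegral0 R); apply: eq_cintegral => x.
set d := l - k; have d0 : d != 0 by rewrite subr_eq0 eq_sym.
rewrite /box /win; case: ifPn => [/andP[x0 x1]|_]; last by rewrite mul0r.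
case: ifPn => [/andP[xd0 xd1]|_]; last by rewrite mulr0 conjc0 mulr0.
(* Both x and x - d lie in [[0, 1[], so the nonzero integer d would satisfy |d| < 1. *)
have d1 : d%:~R < 1 :> R by lra.
have d2 : - 1 < d%:~R :> R by lra.
move: d1 d2; rewrite -[X in _ < X -> _](mulr1z 1) ltr_int.
rewrite -(mulrNz 1 1) ltr_int => d1 d2.
by exfalso; move/eqP: d0; apply; lia.
Qed.

(** U^m stretches [[0, 1[] to [[0, N^m[], which is tiled by unit translates; the factor
    [expi (r%:R * theta i)] undoes the phase carried by T^r. The coefficients depend on i only
    through [theta i], which is how equal angles produce equal coefficients. *)
Lemma iter_opU_bx (m : nat) i : (sigma ^+ m)%g = 1%g ->
  iter m (opU N sigma) (bx i) = fun i' x => \sum_(r <- iota 0 (N ^ m))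
    (Complex ((Num.sqrt N%:R)^-1 ^+ m) 0 * expi (r%:R * theta i)) *
    T r%:Z (bx i) i' x.
Proof.
move=> sm; apply/funext => i'; apply/funext => x.
rewrite iter_opUE sm perm1.
have M0 : 0 < N%:R ^+ m :> R by rewrite exprn_gt0// ltr0n.
transitivity (Complex ((Num.sqrt N%:R)^-1 ^+ m) 0 *
  \sum_(0 <= r < N ^ m) single i (fun y => box (y - r%:R)) i' x).
  congr (_ * _); rewrite /single; case: eqP => _; last by rewrite big1.
  by rewrite box_sum /box /win natrX ltr_pdivrMr// mul1r pmulr_lge0// invr_gt0.
rewrite mulr_sumr /index_iota subn0; apply: eq_bigr => r _.
rewrite -mulrA; congr (_ * _); rewrite TpowE /single.
case: eqP => [->|_]; last by rewrite !mulr0.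
by rewrite mulrA -expiD -!pmulrn subrr expi0 mul1r.
Qed.

(** Since T is unitary and its powers commute, both sides involve only the numbers <f, T^(k-r) phi>.
    The combination of translates passes from f to phi, so coefficients of different f become
    coefficients of one vector in the orbit of phi. *)
Lemma inner_convolution (s : seq nat) (a : nat -> C) (f phi : vec R n) (k : int) :
  L2n f -> L2n phi ->
  inner (fun i x => \sum_(r <- s) conjc (a r) * T (- r%:Z) phi i x) (T (- k) f) =
  conjc (inner (fun i x => \sum_(r <- s) a r * T r%:Z f i x) (T k phi)).
Proof.
move=> Lf Lphi.
rewrite inner_lincombl; [|by move=> ?; exact: L2n_Tpow|exact: L2n_Tpow].
rewrite inner_lincombl; [|by move=> ?; exact: L2n_Tpow|exact: L2n_Tpow].
rewrite conjc_sum; apply: eq_bigr => r _; rewrite conjcM; congr (_ * _).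
rewrite !inner_Tpow_shift// -innerC//; last exact: L2n_Tpow.
rewrite -[RHS](inner_Tpow theta (r%:Z - k))//; last exact: L2n_Tpow.
rewrite -TpowD (_ : r%:Z - k + (k - r%:Z) = 0) ?Tpow0; last by ring.
by congr (inner _ (T _ _)); ring.
Qed.

Lemma sqn_lincomb (I : eqType) (s : seq I) (c : I -> C) (e : I -> vec R n) :
  (forall k, L2n (e k)) -> uniq s ->
  {in s &, forall a b, inner (e a) (e b) = (a == b)%:R} ->
  sqn (fun i x => \sum_(k <- s) c k * e k i x) = \sum_(k <- s) normc (c k) ^+ 2.
Proof.
move=> Le us oe; have Lq := L2n_lincomb c Le s.
have L0 : L2n ((fun _ _ => 0) : vec R n) by move=> i; exact: L2_0.
have := sqn_dist_lincomb c L0 Le us oe.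
rewrite [in X in _ = X -> _]/sqn inner0l /= sub0r.
under eq_bigr do rewrite inner0l normc0 expr0n/=.
rewrite big1// oppr0 add0r.
under [X in _ = X -> _]eq_bigr do rewrite inner0l sub0r normcN.
move=> <-; rewrite /sqn innerBl//; last exact: L2nB.
by rewrite !innerBr// (innerC L0 Lq) !inner0l conjc0 subr0 !sub0r opprK.
Qed.

(* Two vectors with the same expansion coefficients over the T-orbits of two
   jointly orthonormal generators have total energy at most 1 along the T-orbit
   of a single orthonormal generator: the reversed conjugate coefficients
   define a unit vector of the cyclic space, to which Bessel applies. *)
Lemma two_orbits_bound (phi : vec R n) (m : nat) (i j : 'I_n) (s : seq int) :
  L2n phi -> (forall a b : int, inner (T a phi) (T b phi) = (a == b)%:R) ->
  i != j -> theta i = theta j -> (sigma ^+ m)%g = 1%g -> uniq s ->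
  \sum_(k <- s) normc (inner (iter m (opU N sigma) (bx i)) (T k phi)) ^+ 2 +
  \sum_(k <- s) normc (inner (iter m (opU N sigma) (bx j)) (T k phi)) ^+ 2 <= 1.
Proof.
move=> Lphi ophi ij thij sm us.
pose a (r : nat) : C :=
  Complex ((Num.sqrt N%:R)^-1 ^+ m) 0 * expi (r%:R * theta i).
rewrite !iter_opU_bx// -thij -/a.
pose w : vec R n :=
  fun i x => \sum_(r <- iota 0 (N ^ m)) conjc (a r) * T (- r%:Z) phi i x.
have LT (k : int) : L2n (T k phi) by exact: L2n_Tpow.
have Lw : L2n w by apply: L2n_lincomb => r; exact: LT.
have w1 : sqn w = 1.
  rewrite /w sqn_lincomb//.
  (* There are N^m coefficients, each of squared modulus N^-m. *)
  - rewrite (eq_bigr (fun=> (N%:R ^+ m)^-1)); last first.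
      move=> r _; rewrite normc_conj normcM normc_expi mulr1 normc_real.
      rewrite real_normK ?num_real// -exprM mulnC exprM exprVn sqr_sqrtr//.
      by rewrite exprVn.
    rewrite big_const_seq iter_addr_0 count_predT size_iota -[LHS]mulr_natr natrX.
    by rewrite mulVf// expf_neq0// pnatr_eq0 -lt0n.
  - exact: iota_uniq.
  - by move=> r q _ _; rewrite ophi eqr_opp.
pose e (b : 'I_n * int) := T b.2 (bx b.1).
(* The two sums become a single Bessel sum for w; i and j being distinct, the indices do not
   repeat. *)
pose S := [seq (i, - k) | k <- s] ++ [seq (j, - k) | k <- s].
have := @bessel R n _ S e w Lw.
have Le b : L2n (e b) by apply: L2n_Tpow; exact: L2n_bx.
have uS : uniq S.
  rewrite cat_uniq !map_inj_uniq; try by move=> x y [] /oppr_inj.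
  rewrite us /= andbT; apply/hasPn => _ /mapP[k _ ->]; apply/mapP => -[l _ [ji _]].
  by rewrite ji eqxx in ij.
have conv i0 (k : int) : inner w (e (i0, - k)) = conjc (inner (fun i x =>
    \sum_(r <- iota 0 (N ^ m)) a r * T r%:Z (bx i0) i x) (T k phi)).
  exact: inner_convolution (L2n_bx i0) Lphi.
move=> /(_ Le uS (fun a b _ _ => Tpow_bx_orthonormal a b)).
rewrite w1 big_cat !big_map /=; apply: le_trans.
rewrite le_eqVlt; apply/orP; left; apply/eqP; congr (_ + _); apply: eq_bigr => k _.
  by rewrite conv normc_conj.
by rewrite conv normc_conj.
Qed.

(** A finite combination q of the e k lies within sqrt (d / 2) of v, so the squared distance from f
    to q is at most 2 |f - v|^2 + 2 (d / 2), and the energy of f along the indices of q misses at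
    most that much. The bound is stated for every larger index set so that the sets obtained for two
    vectors can be merged. *)
Lemma closed_span_energy (e : int -> vec R n) (f v : vec R n) (d : R) :
  (forall k, L2n (e k)) -> (forall a b, inner (e a) (e b) = (a == b)%:R) ->
  0 < d -> L2n f -> closed_span (range e) v ->
  exists s : seq int, uniq s /\
    forall s' : seq int, uniq s' -> {subset s <= s'} ->
    sqn f - (2 * sqn (fun i x => f i x - v i x) + d) <=
    \sum_(k <- s') normc (inner f (e k)) ^+ 2.
Proof.
move=> Le oe d0 Lf [Lv /(_ (Num.sqrt (d / 2)))[]]; first by rewrite sqrtr_gt0 divr_gt0.
move=> t [c [u [ue]]].
have /fin_all_exists[k uk] : forall l, exists k, u l = e k.
  by move=> l; have [k _ <-] := ue l; exists k.
have -> : (fun i x => v i x - \sum_(l < t) c l * u l i x) =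
          (fun i x => v i x - \sum_(l <- index_enum 'I_t) c l * e (k l) i x).
  by apply/funext => i; apply/funext => x; under eq_bigr do rewrite uk.
have Lq : L2n (fun i x => \sum_(l <- index_enum 'I_t) c l * e (k l) i x).
  exact: (L2n_lincomb c (fun l => Le (k l))).
rewrite sqnormnE ?lte_fin; last exact: L2nB.
rewrite sqr_sqrtr ?divr_ge0 ?ltW// => vq.
exists (undup [seq k l | l <- index_enum 'I_t]); split; first exact: undup_uniq.
move=> s' us' ss'.
(* The same translate may occur several times in the combination; its coefficients are collected. *)
pose c' (b : int) := \sum_(l <- index_enum 'I_t | k l == b) c l.
have qE : (fun i x => \sum_(l <- index_enum 'I_t) c l * e (k l) i x) =
          (fun i x => \sum_(b <- s') c' b * e b i x).
  apply/funext => i; apply/funext => x; rewrite /c'.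
  under [RHS]eq_bigr do rewrite mulr_suml.
  rewrite (exchange_big_dep xpredT)//=; apply: eq_bigr => l _.
  rewrite -big_filter (_ : seq.filter _ _ = [:: k l]) ?big_seq1//.
  have kls : k l \in s' by apply: ss'; rewrite mem_undup map_f// mem_index_enum.
  rewrite (eq_filter (a2 := pred1 (k l))) ?filter_pred1_uniq//.
rewrite qE in Lq.
have oes : {in s' &, forall a b, inner (e a) (e b) = (a == b)%:R} by [].
have := sqn_dist_lincomb c' Lf Le us' oes.
set q := (fun i x => \sum_(b <- s') _) in qE Lq *.
have sq : sqn (fun i x => f i x - q i x) <= 2 * sqn (fun i x => f i x - v i x) + d.
  have := sqnD_le (L2nB Lf Lv) (L2nB Lv Lq).
  have -> : (fun i x => f i x - v i x + (v i x - q i x)) =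
            (fun i x => f i x - q i x).
    by apply/funext => i; apply/funext => x; ring.
  have vq' : sqn (fun i x => v i x - q i x) < d / 2.
    rewrite (_ : (fun i x => v i x - q i x) = fun i x =>
      v i x - \sum_(l <- index_enum 'I_t) c l * e (k l) i x)//.
    by apply/funext => i; apply/funext => x;
      rewrite -[q i x](congr1 (fun h => h i x) qE).
  move: vq'; lra.
have : 0 <= \sum_(k <- s') normc (inner f (e k) - c' k) ^+ 2.
  by apply: sumr_ge0 => b _; exact: sqr_ge0.
move: sq; lra.
Qed.

(** A finite combination of the affine system approximates f. U^m preserves the distance and, once m
    exceeds every |j| that occurs, carries each level j to a positive level, that is, into V_0. *)
Lemma GMRA_approx (r : nat) (Psi : 'I_r -> vec R n) (f : vec R n) (d : R) :
  (forall p, L2n (Psi p)) -> L2n f -> 0 < d ->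
  closed_span (range (affine_system N sigma theta Psi)) f ->
  exists m0 : nat, forall m : nat, (m0 <= m)%N ->
    exists2 v, GMRA N sigma theta Psi 0 v &
      sqn (fun i x => iter m (opU N sigma) f i x - v i x) < d.
Proof.
move=> LPsi Lf d0 [_ /(_ (Num.sqrt d))[]]; first by rewrite sqrtr_gt0.
move=> t [c [u [ue]]].
have /fin_all_exists[a ua] : forall l, exists a, u l = affine_system N sigma theta Psi a.
  by move=> l; have [a _ <-] := ue l; exists a.
have Lu l : L2n (u l).
  by rewrite ua; case: (a l) => [[j k] p]; apply: L2n_Upow => //; exact: L2n_Tpow.
have Lq : L2n (fun i x => \sum_(l < t) c l * u l i x) by exact: L2n_lincomb.
rewrite sqnormnE ?lte_fin; last exact: L2nB.
rewrite sqr_sqrtr ?ltW// => fq.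
(* The sum dominates every |j|; the successor gives the strict inequality 0 < m + j demanded by
   V_0. *)
exists (\sum_(l < t) `|(a l).1.1|%N).+1 => m mm0.
have opUlin (g : 'I_n -> R -> C) k : iter k (opU N sigma) g =
    fun i x => Complex ((Num.sqrt N%:R)^-1 ^+ k) 0 *
      g ((sigma ^+ k)%g i) (x / N%:R ^+ k).
  by apply/funext => i; apply/funext => x; rewrite iter_opUE.
pose v : vec R n := fun i x => \sum_(l < t) c l * iter m (opU N sigma) (u l) i x.
have vE : v = iter m (opU N sigma) (fun i x => \sum_(l < t) c l * u l i x).
  apply/funext => i; apply/funext => x; rewrite /v opUlin mulr_sumr.
  by apply: eq_bigr => l _; rewrite opUlin mulrCA.
have LU g : L2n g -> L2n (iter m (opU N sigma) g).
  by apply: L2n_iter => ?; exact: L2n_opU.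
exists v.
  split; first by rewrite vE; exact: LU.
  move=> eps eps0; exists t, c, (fun l => iter m (opU N sigma) (u l)); split.
    move=> l; rewrite ua; case E : (a l) => [[j k] p].
    have mj : 0 < m%:Z + j.
      have : (`|j| <= \sum_(l < t) `|(a l).1.1|)%N.
        by rewrite (bigD1 l)//= E/= leq_addr.
      by move: mm0; lia.
    exists (m%:Z + j), k, p; split; first by rewrite oppr0.
    by rewrite /affine_system UpowD_nat// ltW.
  rewrite (_ : (fun i x => _) = fun _ _ => 0); last first.
    by apply/funext => i; apply/funext => x; rewrite subrr.
  have L0 : L2n ((fun _ _ => 0) : vec R n) by move=> i; exact: L2_0.
  by rewrite sqnormnE// /sqn inner0l /= lte_fin exprn_gt0.
rewrite vE (_ : (fun i x => _) = iter m (opU N sigma)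
    (fun i x => f i x - \sum_(l < t) c l * u l i x)).
  rewrite /sqn inner_iter//; try exact: L2nB; first by move=> ?; exact: L2n_opU.
  by move=> ? ?; exact: inner_opU.
by apply/funext => i; apply/funext => x; rewrite !opUlin mulrBr.
Qed.

Lemma no_MRA_wavelet : (exists i j : 'I_n, i <> j /\ theta i = theta j) ->
  ~ exists (r : nat) (Psi : 'I_r -> vec R n), MRA_wavelet N sigma theta Psi.
Proof.
move=> [i [j [/eqP ij thij]]] [r [Psi [[[LPsi _] [_ _ onb]] [phi [_ [LTphi ophi V0]]]]]].
have Lphi : L2n phi by rewrite -(Tpow0 theta phi).
(* With error 1/16 here and slack d = 1/16 below, each vector keeps energy at least 1 - 3/16 along
   the orbit of phi; the total 26/16 contradicts the bound 1. *)
have app k : exists m0 : nat, forall m : nat, (m0 <= m)%N ->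
    exists2 v, GMRA N sigma theta Psi 0 v &
      sqn (fun i x => iter m (opU N sigma) (bx k) i x - v i x) < 1 / 16.
  apply: GMRA_approx => //; first exact: L2n_bx.
  by rewrite onb; exact: L2n_bx.
have [mi hi] := app i; have [mj hj] := app j.
(* Large enough for both approximations, and a multiple of the order of [sigma], so that U^m maps
   each component to itself. *)
pose m := (#[sigma]%g * (mi + mj))%N.
have o0 : (0 < #[sigma]%g)%N by exact: order_gt0.
have mim : (mi <= m)%N by rewrite (leq_trans (leq_addr mj mi))// leq_pmull.
have mjm : (mj <= m)%N by rewrite (leq_trans (leq_addl mi mj))// leq_pmull.
have sm : (sigma ^+ m)%g = 1%g by rewrite expgM expg_order expg1n.
have LU k : L2n (iter m (opU N sigma) (bx k)).
  by apply: L2n_iter => [? ?|]; [exact: L2n_opU|exact: L2n_bx].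
have U1 k : sqn (iter m (opU N sigma) (bx k)) = 1.
  rewrite /sqn inner_iter//; [|by move=> ?; exact: L2n_opU
    |by move=> ? ?; exact: inner_opU|exact: L2n_bx|exact: L2n_bx].
  by have := Tpow_bx_orthonormal (k, 0) (k, 0); rewrite eqxx !Tpow0 => ->.
have d0 : 0 < 1 / 16 :> R by lra.
have [v + vi] := hi _ mim; have [w + wj] := hj _ mjm.
rewrite -V0 => wV vV.
have [s [us hs]] := closed_span_energy LTphi ophi d0 (LU i) vV.
have [t [ut ht]] := closed_span_energy LTphi ophi d0 (LU j) wV.
pose S := undup (s ++ t).
have uS : uniq S by exact: undup_uniq.
have := two_orbits_bound Lphi ophi ij thij sm uS.
have := hs S uS; rewrite U1 => /(_ _)/wrap[].
  by move=> k ks; rewrite mem_undup mem_cat ks.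
have := ht S uS; rewrite U1 => /(_ _)/wrap[].
  by move=> k kt; rewrite mem_undup mem_cat kt orbT.
move: vi wj; lra.
Qed.

End NoMRA.

(** * Functions with Fourier transform an indicator *)

Section ParametricIntegrals.
Variable R : realType.
Local Notation C := R[i].
Local Notation mu := (@lebesgue_measure R).
Local Notation RR := (measurableTypeR R * measurableTypeR R)%type.
Implicit Types H : R -> R -> C.

Definition cmeasurable2 H :=
  measurable_fun [set: RR] (fun z : RR => complex.Re (H z.1 z.2)) /\
  measurable_fun [set: RR] (fun z : RR => complex.Im (H z.1 z.2)).

Lemma cmeasurable2M H K : cmeasurable2 H -> cmeasurable2 K ->
  cmeasurable2 (fun x y => H x y * K x y).
Proof.
move=> [f1 f2] [g1 g2]; split.
  by under eq_fun do rewrite ReM; apply: measurable_funB; exact: measurable_funM.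
by under eq_fun do rewrite ImM; apply: measurable_funD; exact: measurable_funM.
Qed.

Lemma cmeasurable2_fst (f : R -> C) : cmeasurable f ->
  cmeasurable2 (fun x _ => f x).
Proof.
move=> [f1 f2]; split.
- exact: (measurableT_comp f1 measurable_fst).
- exact: (measurableT_comp f2 measurable_fst).
Qed.

Lemma cmeasurable2_snd (f : R -> C) : cmeasurable f ->
  cmeasurable2 (fun _ y => f y).
Proof.
move=> [f1 f2]; split.
- exact: (measurableT_comp f1 measurable_snd).
- exact: (measurableT_comp f2 measurable_snd).
Qed.

Lemma cmeasurable2_expiM : cmeasurable2 (fun x y => expi (x * y)).
Proof.
have mM : measurable_fun [set: RR] (fun z : RR => z.1 * z.2 : R).
  by apply: measurable_funM; [exact: measurable_fst|exact: measurable_snd].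
have [c s] := cmeasurable_expi (@measurable_id _ R setT).
split.
- exact: (measurableT_comp c mM).
- exact: (measurableT_comp s mM).
Qed.

(** Integrability is not assumed: Tonelli makes the integrals of the positive and negative parts
    measurable, and [fine] of their difference is measurable whatever its value. *)
Lemma cmeasurable_cintegral H : cmeasurable2 H ->
  cmeasurable (fun x => cintegral (H x)).
Proof.
have key (h : RR -> R) : measurable_fun [set: RR] h ->
    measurable_fun setT (fun x : R => \int[mu]_y h (x, y)).
  move=> mh; rewrite /Rintegral; apply: measurableT_comp => //.
  have mh' : measurable_fun [set: RR] (EFin \o h) by exact/measurable_EFinP.
  have -> : (fun x : R => \int[mu]_y (h (x, y))%:E)%E =
    ((fun x => \int[mu]_y (EFin \o h)^\+ (x, y)) \-
     (fun x => \int[mu]_y (EFin \o h)^\- (x, y)))%E.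
    apply/funext => x; rewrite -[LHS]/(\int[mu]_y (EFin \o h) (x, y))%E.
    rewrite [LHS]integralE.
    under eq_integral do rewrite funepos_comp/=.
    by under [X in (_ - X)%E = _]eq_integral do rewrite funeneg_comp/=.
  apply: emeasurable_funB; apply: measurable_fun_fubini_tonelli_F => //.
    exact: measurable_funepos.
  exact: measurable_funeneg.
move=> [h1 h2]; split; rewrite /cintegral /=.
- exact: (key (fun z : RR => complex.Re (H z.1 z.2))).
- exact: (key (fun z : RR => complex.Im (H z.1 z.2))).
Qed.

(** Fubini for the real and imaginary parts, both dominated by the modulus. Every slice, not just
    almost every one, is assumed integrable, so that passing to [fine] in the inner integrals loses
    nothing at any point. *)
Lemma cFubini H : cmeasurable2 H ->
  (forall x, L1 (H x)) -> (forall y, L1 (H^~ y)) ->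
  (\int[mu]_x \int[mu]_y (normc (H x y))%:E < +oo)%E ->
  cintegral (fun x => cintegral (H x)) = cintegral (fun y => cintegral (H^~ y)).
Proof.
move=> [h1 h2] L1x L1y Hi.
have mn : measurable_fun [set: RR] (fun z : RR => normc (H z.1 z.2)).
  rewrite (_ : (fun _ => _) = Num.sqrt \o (fun z : RR =>
     complex.Re (H z.1 z.2) ^+ 2 + complex.Im (H z.1 z.2) ^+ 2)).
    apply: measurableT_comp.
      by apply: continuous_measurable_fun; exact: sqrt_continuous.
    by apply: measurable_funD; exact: measurable_funX.
  by apply/funext => z /=; rewrite -sqr_normcE sqrtr_sqr ger0_norm// normc_ge0.
have key (h : RR -> R) : measurable_fun [set: RR] h ->
    (forall z, `|h z| <= normc (H z.1 z.2)) ->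
    (forall x, mu.-integrable setT (EFin \o (fun y => h (x, y)))) ->
    (forall y, mu.-integrable setT (EFin \o (fun x => h (x, y)))) ->
    \int[mu]_x \int[mu]_y h (x, y) = \int[mu]_y \int[mu]_x h (x, y).
  move=> mh hH hx hy.
  have mh' : measurable_fun [set: RR] (EFin \o h) by exact/measurable_EFinP.
  have ih : (mu \x mu)%E.-integrable [set: RR] (EFin \o h).
    apply/integrable12ltyP => //; apply: le_lt_trans Hi.
    apply: ge0_le_integral => //.
    - by move=> x _; exact: integral_ge0.
    - apply: (measurable_fun_fubini_tonelli_F (abse \o (EFin \o h))) => //=.
      exact: measurableT_comp.
    - apply: (measurable_fun_fubini_tonelli_F
         (fun z : RR => (normc (H z.1 z.2))%:E)) => //=.
        exact/measurable_EFinP.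
      by move=> z; rewrite lee_fin normc_ge0.
    - move=> x _; apply: ge0_le_integral => //.
      + by apply: measurableT_comp => //; exact: measurable_int (hx x).
      + by apply/measurable_EFinP; apply: measurable_normc; case: (L1x x).
      + by move=> y _ /=; rewrite lee_fin; exact: (hH (x, y)).
  rewrite /Rintegral; congr fine.
  transitivity (\int[mu]_x \int[mu]_y (EFin \o h) (x, y))%E.
    apply: eq_integral => x _; rewrite fineK//.
    exact: (integrable_fin_num measurableT (hx x)).
  rewrite (Fubini ih); apply: eq_integral => y _; rewrite fineK//.
  exact: (integrable_fin_num measurableT (hy y)).
have Rx x := (L1_integrable (L1x x)).1; have Ix x := (L1_integrable (L1x x)).2.
have Ry y := (L1_integrable (L1y y)).1; have Iy y := (L1_integrable (L1y y)).2.
apply: complex_eq; rewrite /cintegral /=.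
- apply: (key (fun z : RR => complex.Re (H z.1 z.2)) h1 _ Rx Ry) => z.
  exact: ler_Re_normc.
- apply: (key (fun z : RR => complex.Im (H z.1 z.2)) h2 _ Ix Iy) => z.
  exact: ler_Im_normc.
Qed.

End ParametricIntegrals.

(** * Bumps: scaling, integer samples and pointwise modulus *)

Section Bump.
Variable R : realType.
Local Notation C := R[i].
Local Notation mu := (@lebesgue_measure R).
Implicit Types A B D x : R.

(* The inverse Fourier transform of the indicator function of [A, B[. *)
Definition bump A B x : C :=
  Complex (2 * pi)^-1 0 * cintegral (fun xi => win A B xi * expi (x * xi)).

Lemma cmeasurable_win_expi A B x :
  cmeasurable (fun xi => win A B xi * expi (x * xi)).
Proof.
apply: cmeasurableM; first exact: cmeasurable_win.
by apply: cmeasurable_expi; exact: mulrl_measurable.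
Qed.

Lemma normc_win_expi A B x xi :
  normc (win A B xi * expi (x * xi)) = \1_(`[A, B[%classic) xi.
Proof. by rewrite normcM normc_expi mulr1 normc_win. Qed.

Lemma L1_win_expi A B x : L1 (fun xi => win A B xi * expi (x * xi)).
Proof.
apply: (@L1_le _ _ (\1_(`[A, B[%classic))).
- exact: cmeasurable_win_expi.
- exact: measurable_indic.
- by move=> xi; rewrite normc_win_expi.
- by rewrite integral_indic// setIT/= lebesgue_measure_itv/=; case: ifP; rewrite ltry.
Qed.

Lemma winD A B D xi : A <= B -> B <= D ->
  win A D xi = win A B xi + win B D xi.
Proof.
move=> AB BD; rewrite /win.
case: (ltP xi B) => xB; rewrite ?andbT ?andbF ?add0r ?addr0.
  by rewrite (lt_le_trans xB BD) andbT.
by rewrite (le_trans AB xB).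
Qed.

Lemma bumpD A B D x : A <= B -> B <= D -> bump A D x = bump A B x + bump B D x.
Proof.
move=> AB BD; rewrite /bump -mulrDr -cintegralD; [|exact: L1_win_expi..].
by congr (_ * _); apply: eq_cintegral => xi; rewrite (winD _ AB BD) mulrDl.
Qed.

Lemma bumpxx A x : bump A A x = 0.
Proof.
rewrite /bump (_ : cintegral _ = 0) ?mulr0// -[RHS](cintegral0 R).
apply: eq_cintegral => xi; rewrite /win; case: ifPn; last by rewrite mul0r.
by move=> /andP[/le_lt_trans/[apply]]; rewrite ltxx.
Qed.

Lemma win_scale c A B xi : 0 < c -> win A B (c * xi) = win (A / c) (B / c) xi.
Proof.
by move=> c0; rewrite /win ler_pdivrMr// ltr_pdivlMr// mulrC.
Qed.

Lemma bump_scale c A B x : 0 < c ->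
  bump A B (x / c) = Complex c 0 * bump (A / c) (B / c) x.
Proof.
move=> c0; rewrite /bump mulrCA; congr (_ * _).
have -> : cintegral (fun xi => win (A / c) (B / c) xi * expi (x * xi)) =
    cintegral (fun xi => win A B (c * xi + 0) * expi (x / c * (c * xi + 0))).
  apply: eq_cintegral => xi; rewrite addr0 win_scale//; congr (_ * expi _).
  by field; exact: lt0r_neq0.
rewrite (cintegral_affine 0 c0 (L1_win_expi A B (x / c))) mulrA.
have -> : Complex c 0 * Complex c^-1 0 = 1.
  apply: complex_eq => /=; last by rewrite mulr0 mul0r addr0.
  by rewrite mulr0 subr0 divff// lt0r_neq0.
by rewrite mul1r.
Qed.

Lemma Rintegral_win_FTC (f F : R -> R) A B : A <= B -> continuous f ->
  (forall x, is_derive x 1 F (f x)) ->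
  \int[mu]_x (\1_(`[A, B[%classic) x * f x) = F B - F A.
Proof.
move=> AB cf dF.
have cF : continuous F.
  by move=> x; apply: differentiable_continuous; apply/derivable1_diffP.
transitivity (\int[mu]_(x in `[A, B[) f x).
  rewrite [RHS]Rintegral_mkcond; apply: eq_Rintegral => x _.
  by rewrite patchE indicE; case: (x \in _); rewrite ?mul1r ?mul0r.
have fi : mu.-integrable `[A, B] (EFin \o f).
  apply: continuous_compact_integrable; first exact: segment_compact.
  exact: continuous_subspaceT.
rewrite Rintegral_itv_bndo_bndc; last first.
  by apply: integrableS fi => //; exact: subset_itv_co_cc.
move: AB; rewrite le_eqVlt => /predU1P[->|AB].
  by rewrite set_itv1 Rintegral_set1 subrr.
rewrite /Rintegral (continuous_FTC2 (F := F) AB)//.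
- exact: continuous_subspaceT.
- split.
  + by move=> x _; apply: ex_derive.
  + by apply: cvg_at_right_filter; exact: cF.
  + by apply: cvg_at_left_filter; exact: cF.
- by move=> x _; rewrite derive1E; exact: derive_val.
Qed.

Lemma continuous_cosM x : continuous (fun xi : R => cos (x * xi)).
Proof.
move=> xi; apply: continuous_comp; last exact: continuous_cos.
exact: mulrl_continuous.
Qed.

Lemma continuous_sinM x : continuous (fun xi : R => sin (x * xi)).
Proof.
move=> xi; apply: continuous_comp; last exact: continuous_sin.
exact: mulrl_continuous.
Qed.

Lemma cintegral_win_expi A B x : A <= B -> x != 0 ->
  cintegral (fun xi => win A B xi * expi (x * xi)) =
  Complex ((sin (x * B) - sin (x * A)) / x) ((cos (x * A) - cos (x * B)) / x).
Proof.
move=> AB x0; apply: complex_eq; rewrite /cintegral /=.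
- under eq_Rintegral do rewrite winE /= mul0r subr0.
  have d (xi : R) : is_derive xi (1 : R) (fun xi => sin (x * xi) / x) (cos (x * xi)).
    by apply: is_derive_eq; rewrite /GRing.scale /=; field; exact: x0.
  by rewrite (Rintegral_win_FTC AB (@continuous_cosM x) d) mulrBl.
- under eq_Rintegral do rewrite winE /= mul0r addr0.
  have d (xi : R) : is_derive xi (1 : R) (fun xi => - cos (x * xi) / x) (sin (x * xi)).
    by apply: is_derive_eq; rewrite /GRing.scale /=; field; exact: x0.
  by rewrite (Rintegral_win_FTC AB (@continuous_sinM x) d) mulrBl; ring.
Qed.

Lemma pi2_gt0 : 0 < 2 * pi :> R.
Proof. by rewrite mulr_gt0// pi_gt0. Qed.

(** This is the orthonormality of the functions e^(ik xi) / sqrt (2 pi) on [[A, A + 2 pi[], read as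
    values of the bump at integers. *)
Lemma bump_int A (k : int) :
  bump A (A + 2 * pi) k%:~R = (k == 0)%:R.
Proof.
have p0 : (2 * pi : R) != 0 by exact: lt0r_neq0 pi2_gt0.
have AB : A <= A + 2 * pi by rewrite lerDl ltW// pi2_gt0.
rewrite /bump; have [->|k0] := eqVneq k 0.
  under eq_cintegral do rewrite mulr0z mul0r expi0 mulr1.
  have := sqnorm_inner (L2_win A (A + 2 * pi)).
  under eq_cintegral do rewrite conjc_win winM.
  move=> ->; rewrite sqnorm_win//= addrAC subrr add0r.
  by apply: complex_eq => /=; rewrite ?mulr0 ?mul0r ?subr0 ?addr0// mulVf.
rewrite cintegral_win_expi//; last by rewrite intr_eq0.
have := expi_2pi R k; rewrite /expi => -[c1 s0].
have -> : k%:~R * (A + 2 * pi) = k%:~R * A + 2 * k%:~R * pi by ring.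
rewrite sinD cosD c1 s0 !mulr1 !mulr0 addr0 subr0 !subrr mul0r.
by apply: complex_eq => /=; rewrite ?mulr0 ?mul0r ?subr0 ?addr0.
Qed.

Lemma cmeasurable_bump A B : cmeasurable (bump A B).
Proof.
apply: cmeasurableM; first exact: cmeasurable_cst.
apply: (cmeasurable_cintegral (H := fun x xi => win A B xi * expi (x * xi))).
apply: cmeasurable2M; last exact: cmeasurable2_expiM.
by apply: cmeasurable2_snd; exact: cmeasurable_win.
Qed.

(** The numerator comes from |e^(ixB) - e^(ixA)|^2 = 2 - 2 cos ((B - A) x). *)
Lemma sqr_normc_bump A B x : A <= B -> x != 0 ->
  normc (bump A B x) ^+ 2 =
  (2 * pi ^+ 2)^-1 * ((1 - cos ((B - A) * x)) / x ^+ 2).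
Proof.
move=> AB x0; rewrite /bump cintegral_win_expi// normcM exprMn !sqr_normcE /=.
have p0 : (pi : R) != 0 by rewrite lt0r_neq0// pi_gt0.
have -> : cos ((B - A) * x) =
    cos (x * B) * cos (x * A) + sin (x * B) * sin (x * A).
  by rewrite mulrBl cosB ![x * _]mulrC.
move: (pi : R) p0 => p p0.
have a1 := cos2Dsin2 (x * A); have b1 := cos2Dsin2 (x * B).
transitivity ((2 * p)^-1 ^+ 2 * (((cos (x * B) ^+ 2 + sin (x * B) ^+ 2) +
  (cos (x * A) ^+ 2 + sin (x * A) ^+ 2) - 2 * (cos (x * B) * cos (x * A) +
    sin (x * B) * sin (x * A))) / x ^+ 2)).
  by field; rewrite x0 p0.
by rewrite a1 b1; field; rewrite x0 p0.
Qed.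

End Bump.

(** * The L^2 norm of a bump, through Laplace transforms *)

Section BumpNorm.
Variable R : realType.
Local Notation mu := (@lebesgue_measure R).
Implicit Types a t x L : R.

Lemma cvgy_expRN a : 0 < a -> expR (- (a * t)) @[t --> +oo] --> (0 : R).
Proof.
move=> a0; apply: (@cvg_comp _ _ _ (fun t => a * t) (fun z => expR (- z)) _
  (pinfty_nbhs R)); last exact: cvgr_expR.
exact: gt0_cvgMry.
Qed.

(** Half of the exponential absorbs the factor t: e^(at/2) >= 1 + at/2 gives t <= (2/a) e^(at/2) for
    t >= 0. *)
Lemma cvgy_mul_expRN a : 0 < a -> t * expR (- (a * t)) @[t --> +oo] --> (0 : R).
Proof.
move=> a0.
have a2 : 0 < a / 2 by rewrite divr_gt0.
apply: (@squeeze_cvgr _ _ _ _ (cst 0) (fun t => (2 / a) * expR (- (a / 2 * t)))).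
- near=> t; have t0 : 0 <= t by near: t; exact: nbhs_pinfty_ge.
  apply/andP; split; first by rewrite mulr_ge0// expR_ge0.
  have -> : - (a * t) = - (a / 2 * t) + - (a / 2 * t) by field.
  rewrite expRD mulrA ler_wpM2r ?expR_ge0// expRN ler_pdivrMr ?expR_gt0//.
  have := expR_ge1Dx (a / 2 * t).
  set e := expR _ => H; apply: (@le_trans _ _ (2 / a * (a / 2 * t))).
    by rewrite le_eqVlt; apply/orP; left; apply/eqP; field; exact: lt0r_neq0.
  by rewrite ler_wpM2l ?divr_ge0 ?ltW//; lra.
- exact: cvg_cst.
- by rewrite -[X in _ --> X](mulr0 (2 / a)); apply: cvgM; [exact: cvg_cst|exact: cvgy_expRN].
Unshelve. all: by end_near. Qed.

Lemma continuous_expRNM a : continuous (fun t : R => expR (- (a * t))).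
Proof.
move=> t; apply: continuous_comp; last exact: continuous_expR.
by apply: continuousN; exact: mulrl_continuous.
Qed.

(** With a = |x| this writes the factor 1 / x^2 of the squared bump as an integral over t, which
    opens the way to Tonelli. *)
Lemma integral_gammalike a : 0 < a ->
  (\int[mu]_(t in `[0%R, +oo[) (t * expR (- (a * t)))%:E = (a ^- 2)%:E)%E.
Proof.
move=> a0; have an := lt0r_neq0 a0.
pose F (t : R) := - (t * expR (- (a * t)) / a) - expR (- (a * t)) / a ^+ 2.
have dF (t : R) : is_derive t (1 : R) F (t * expR (- (a * t))).
  by apply: is_derive_eq; rewrite /GRing.scale /=; field; exact: an.
have cF : continuous F.
  by move=> t; apply: differentiable_continuous; apply/derivable1_diffP; apply: ex_derive.
have cf : continuous (fun t : R => t * expR (- (a * t))).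
  by move=> t; apply: cvgM; [exact: cvg_id|exact: continuous_expRNM].
rewrite (@ge0_continuous_FTC2y _ _ F 0 0).
- by rewrite /F mul0r mulr0 oppr0 expR0 mul0r mul1r oppr0 sub0r -EFinN opprK add0e.
- by move=> t t0; rewrite mulr_ge0// expR_ge0.
- exact: continuous_subspaceT.
- rewrite -[X in _ --> X](_ : - (0 / a) - 0 / a ^+ 2 = 0); last first.
    by rewrite !mul0r !oppr0 addr0.
  apply: cvgB; last by apply: cvgM; [exact: cvgy_expRN|exact: cvg_cst].
  by apply: cvgN; apply: cvgM; [exact: cvgy_mul_expRN|exact: cvg_cst].
- by move=> t _; apply: ex_derive.
- by apply: cvg_at_right_filter; exact: cF.
- by move=> t _; rewrite derive1E; exact: derive_val.
Qed.

(** The Laplace transform of 1 - cos (L x), namely 1/t - t / (t^2 + L^2), from an explicit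
    primitive. *)
Lemma integral_laplace_1Bcos L t : 0 < t ->
  (\int[mu]_(x in `[0%R, +oo[) ((1 - cos (L * x)) * expR (- (t * x)))%:E =
    (L ^+ 2 / (t * (t ^+ 2 + L ^+ 2)))%:E)%E.
Proof.
move=> t0; have tn := lt0r_neq0 t0.
have tL : t ^+ 2 + L ^+ 2 != 0.
  by rewrite lt0r_neq0// ltr_wpDr ?sqr_ge0// exprn_gt0.
pose F (x : R) := - (expR (- (t * x)) / t) -
  expR (- (t * x)) * (L * sin (L * x) - t * cos (L * x)) / (t ^+ 2 + L ^+ 2).
have dF (x : R) : is_derive x (1 : R) F ((1 - cos (L * x)) * expR (- (t * x))).
  apply: is_derive_eq; rewrite /GRing.scale /=; field.
  by rewrite ?tn ?tL.
have cF : continuous F.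
  by move=> x; apply: differentiable_continuous; apply/derivable1_diffP; apply: ex_derive.
have cf : continuous (fun x : R => (1 - cos (L * x)) * expR (- (t * x))).
  move=> x; apply: cvgM; last exact: continuous_expRNM.
  by apply: cvgB; [exact: cvg_cst|exact: continuous_cosM].
rewrite (@ge0_continuous_FTC2y _ _ F 0 0).
- rewrite /F !mulr0 oppr0 expR0 sin0 cos0 -EFinB; congr EFin.
  by field; rewrite tn tL.
- by move=> x _; rewrite mulr_ge0 ?expR_ge0// subr_ge0 cos_le1.
- exact: continuous_subspaceT.
- have E0 := cvgy_expRN t0.
  rewrite -[X in _ --> X](_ : - (0 / t) - 0 = 0); last by rewrite mul0r !oppr0 addr0.
  apply: cvgB; first by apply: cvgN; apply: cvgM => //; exact: cvg_cst.
  (* K bounds the oscillating factor, so the decay of the exponential settles the limit. *)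
  pose K := (`|L| + `|t|) / (t ^+ 2 + L ^+ 2).
  apply: norm_cvg0.
  apply: (@squeeze_cvgr _ _ _ _ (cst 0) (fun x => K * expR (- (t * x)))).
  + near=> x; rewrite normr_ge0 /=; set u := L * _ - _.
    have -> : `|expR (- (t * x)) * u / (t ^+ 2 + L ^+ 2)| =
        `|u| / (t ^+ 2 + L ^+ 2) * expR (- (t * x)).
      rewrite !normrM normfV (ger0_norm (expR_ge0 _)).
      have d0 : 0 <= t ^+ 2 + L ^+ 2 by rewrite addr_ge0 ?sqr_ge0.
      by rewrite (ger0_norm d0) -[LHS]mulrA mulrC.
    rewrite ler_wpM2r ?expR_ge0// ler_wpM2r ?invr_ge0 ?addr_ge0 ?sqr_ge0//.
    apply: le_trans (ler_normB _ _) _; rewrite !normrM lerD//.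
      by rewrite ler_piMr// sin_max.
    by rewrite ler_piMr// cos_max.
  + exact: cvg_cst.
  + by rewrite -[X in _ --> X](mulr0 K); apply: cvgM => //; exact: cvg_cst.
- by move=> x _; apply: ex_derive.
- by apply: cvg_at_right_filter; exact: cF.
- by move=> x _; rewrite derive1E; exact: derive_val.
Unshelve. all: by end_near. Qed.

Lemma integral_atanlike L : 0 < L ->
  (\int[mu]_(t in `[0%R, +oo[) (L ^+ 2 / (t ^+ 2 + L ^+ 2))%:E =
    (L * (pi / 2))%:E)%E.
Proof.
move=> L0; have Ln := lt0r_neq0 L0.
have tL (t : R) : t ^+ 2 + L ^+ 2 != 0.
  by rewrite lt0r_neq0// ltr_wpDl ?sqr_ge0// exprn_gt0.
pose F (t : R) := L * atan (t / L).
have dF (t : R) : is_derive t (1 : R) F (L ^+ 2 / (t ^+ 2 + L ^+ 2)).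
  apply: is_derive_eq; rewrite /GRing.scale /=.
  by field; rewrite Ln ?tL.
have cF : continuous F.
  by move=> x; apply: differentiable_continuous; apply/derivable1_diffP; apply: ex_derive.
have cf : continuous (fun t : R => L ^+ 2 / (t ^+ 2 + L ^+ 2)).
  move=> t; apply: cvgM; first exact: cvg_cst.
  apply: cvgV => //; apply: cvgD; last exact: cvg_cst.
  exact: exprn_continuous.
rewrite (@ge0_continuous_FTC2y _ _ F 0 (L * (pi / 2))).
- by rewrite /F mul0r atan0 mulr0 sube0.
- by move=> t _; rewrite divr_ge0 ?addr_ge0 ?sqr_ge0.
- exact: continuous_subspaceT.
- apply: cvgM; first exact: cvg_cst.
  apply: (@cvg_comp _ _ _ (fun t => t / L) (@atan R) _ (pinfty_nbhs R)).
    by apply: gt0_cvgMly; rewrite ?invr_gt0.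
  exact: cvgy_atan.
- by move=> x _; apply: ex_derive.
- by apply: cvg_at_right_filter; exact: cF.
- by move=> x _; rewrite derive1E; exact: derive_val.
Qed.

Local Notation RR := (measurableTypeR R * measurableTypeR R)%type.

(** A nonnegative function of (x, t) whose integral over t is the squared modulus of the bump at x,
    for x nonzero, and whose integral over x is a multiple of L^2 / (t^2 + L^2) for t > 0. The
    absolute value makes it even in x. *)
Let kern L (z : RR) : R :=
  (2 * pi ^+ 2)^-1 * ((1 - cos (L * z.1)) *
    (\1_(`]0, +oo[%classic) z.2 * (z.2 * expR (- (`|z.1| * z.2))))).

Let kern_ge0 L z : 0 <= kern L z.
Proof.
rewrite /kern indicE; apply: mulr_ge0.
  by rewrite invr_ge0 mulr_ge0 ?sqr_ge0.
apply: mulr_ge0; first by rewrite subr_ge0 cos_le1.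
have [/set_mem/=|_] := boolP (z.2 \in _); last by rewrite mul0r.
by rewrite in_itv/= andbT mul1r => /ltW z0; rewrite mulr_ge0// expR_ge0.
Qed.

Let measurable_kern L : measurable_fun [set: RR] (kern L).
Proof.
have m1 : measurable_fun [set: RR] (fun z : RR => z.1 : R) by exact: measurable_fst.
have m2 : measurable_fun [set: RR] (fun z : RR => z.2 : R) by exact: measurable_snd.
apply: measurable_funM; first exact: measurable_cst.
apply: measurable_funM.
  apply: measurable_funB; first exact: measurable_cst.
  have mc : measurable_fun setT (fun x : R => cos (L * x)).
    by apply: continuous_measurable_fun; exact: continuous_cosM.
  exact: (measurableT_comp mc m1).
apply: measurable_funM.
  have mi : measurable_fun setT (\1_(`]0, +oo[%classic) : R -> R) by exact: measurable_indic.
  exact: (measurableT_comp mi m2).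
apply: measurable_funM => //.
have me : measurable_fun setT (@expR R).
  by apply: continuous_measurable_fun; exact: continuous_expR.
apply: (measurableT_comp me); apply: measurable_funN; apply: measurable_funM => //.
exact: measurableT_comp.
Qed.

Let integral_kern_t L x : x != 0 ->
  (\int[mu]_t (kern L (x, t))%:E =
   ((2 * pi ^+ 2)^-1 * ((1 - cos (L * x)) / x ^+ 2))%:E)%E.
Proof.
move=> x0; have ax : 0 < `|x| by rewrite normr_gt0.
transitivity (\int[mu]_(t in `]0%R, +oo[)
  ((2 * pi ^+ 2)^-1 * (1 - cos (L * x)) * (t * expR (- (`|x| * t))))%:E)%E.
  rewrite [RHS]integral_mkcond; apply: eq_integral => t _.
  rewrite patchE /kern indicE /=; case: (t \in _); last by rewrite mul0r !mulr0.
  by rewrite mul1r mulrA.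
rewrite integral_itv_obnd_cbnd; last first.
  apply/measurable_EFinP; apply: measurable_funTS.
  apply: measurable_funM => //; apply: measurable_funM => //.
  by apply: continuous_measurable_fun; exact: continuous_expRNM.
under eq_integral do rewrite EFinM.
rewrite ge0_integralZl_EFin//; last 3 first.
- move=> t /=; rewrite in_itv/= andbT => t0.
  by rewrite lee_fin mulr_ge0// expR_ge0.
- apply/measurable_EFinP; apply: measurable_funTS; apply: measurable_funM => //.
  by apply: continuous_measurable_fun; exact: continuous_expRNM.
- by rewrite mulr_ge0 ?subr_ge0 ?cos_le1// invr_ge0 mulr_ge0 ?sqr_ge0.
rewrite integral_gammalike// -EFinM real_normK ?num_real//.
by rewrite -mulrA.
Qed.

Let integral_kern_x L t : (\int[mu]_x (kern L (x, t))%:E =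
  (pi ^- 2 * (\1_(`]0, +oo[%classic) t * (L ^+ 2 / (t ^+ 2 + L ^+ 2))))%:E)%E.
Proof.
rewrite /kern /= indicE; have [/set_mem/=|_] := boolP (t \in _); last first.
  under eq_integral do rewrite mul0r !mulr0.
  by rewrite integral0 mul0r mulr0.
rewrite in_itv/= andbT => t0.
have p0 : 0 <= (2 * pi ^+ 2)^-1 :> R by rewrite invr_ge0 mulr_ge0 ?sqr_ge0.
have cg : continuous (fun x : R => (1 - cos (L * x)) * expR (- (`|x| * t))).
  move=> x; apply: cvgM.
    by apply: cvgB; [exact: cvg_cst|exact: continuous_cosM].
  apply: continuous_comp; last exact: continuous_expR.
  apply: cvgN; apply: cvgM; last exact: cvg_cst.
  exact: norm_continuous.
have g0 x : 0 <= (1 - cos (L * x)) * expR (- (`|x| * t)).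
  by rewrite mulr_ge0 ?expR_ge0// subr_ge0 cos_le1.
transitivity (\int[mu]_x (((2 * pi ^+ 2)^-1 * t)%:E *
    ((1 - cos (L * x)) * expR (- (`|x| * t)))%:E))%E.
  by apply: eq_integral => x _; rewrite -EFinM; congr EFin; ring.
rewrite ge0_integralZl_EFin//; last 2 first.
- by apply/measurable_EFinP; apply: continuous_measurable_fun.
- by rewrite mulr_ge0// ltW.
rewrite (ge0_symfun_integralT g0 cg); last first.
  by move=> x /=; rewrite mulrN cosN normrN.
rewrite -set_itvcy.
have -> : (\int[mu]_(x in `[0%R, +oo[)
    ((1 - cos (L * x)) * expR (- (`|x| * t)))%:E =
    (L ^+ 2 / (t * (t ^+ 2 + L ^+ 2)))%:E)%E.
  rewrite -integral_laplace_1Bcos//; apply: eq_integral => x.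
  by rewrite inE/= in_itv/= andbT => x0; rewrite ger0_norm// [t * x]mulrC.
rewrite -!EFinM; congr EFin.
have tL : t ^+ 2 + L ^+ 2 != 0.
  by rewrite lt0r_neq0// ltr_wpDr ?sqr_ge0// exprn_gt0.
have pn : (pi : R) != 0 by rewrite lt0r_neq0// pi_gt0.
have tn := lt0r_neq0 t0.
by move: (pi : R) pn => p pn; field; rewrite pn tn tL.
Qed.

(** Plancherel for an indicator function, by hand: the double integral of [kern] is computed in the
    two orders, and the second one ends in an arctangent. *)
Lemma sqnorm_bump (A B : R) : A < B ->
  sqnorm (bump A B) = ((B - A) / (2 * pi))%:E.
Proof.
move=> AB; set L := B - A; have L0 : 0 < L by rewrite subr_gt0.
have mk : measurable_fun [set: RR] (EFin \o kern L).
  by apply/measurable_EFinP; exact: measurable_kern.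
have k0 z : (0 <= (EFin \o kern L) z)%E by rewrite lee_fin kern_ge0.
transitivity (\int[mu]_x \int[mu]_t (EFin \o kern L) (x, t))%E.
  apply: ge0_ae_eq_integral => //.
  - by apply: measurable_esqr_normc; exact: cmeasurable_bump.
  - exact: (measurable_fun_fubini_tonelli_F (EFin \o kern L)).
  - by move=> x _; rewrite lee_fin sqr_ge0.
  - by move=> x _; exact: integral_ge0.
  (* The closed form of the squared modulus divides by x, so the integrands are compared off the
     null set {0}. *)
  - exists [set 0]; split => //; first exact: lebesgue_measure_set1.
    move=> x /= /not_implyP[_ H]; apply: contrapT => /eqP x0; apply: H.
    by rewrite integral_kern_t// (sqr_normc_bump (ltW AB) x0).
rewrite (fubini_tonelli (EFin \o kern L))//.
under eq_integral do rewrite /= integral_kern_x EFinM.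
have tL (t : R) : t ^+ 2 + L ^+ 2 != 0.
  by rewrite lt0r_neq0// ltr_wpDl ?sqr_ge0// exprn_gt0.
have mf : measurable_fun setT (fun t : R => L ^+ 2 / (t ^+ 2 + L ^+ 2)).
  apply: continuous_measurable_fun => t; apply: cvgM; first exact: cvg_cst.
  by apply: cvgV => //; apply: cvgD; [exact: exprn_continuous|exact: cvg_cst].
rewrite ge0_integralZl_EFin//; last 3 first.
- move=> t _; rewrite lee_fin mulr_ge0// ?divr_ge0 ?addr_ge0 ?sqr_ge0//.
- by apply/measurable_EFinP; apply: measurable_funM => //; exact: measurable_indic.
- by rewrite invr_ge0 sqr_ge0.
have -> : (\int[mu]_t (\1_(`]0%R, +oo[%classic) t *
    (L ^+ 2 / (t ^+ 2 + L ^+ 2)))%:E = (L * (pi / 2))%:E)%E.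
  rewrite -integral_atanlike// -integral_itv_obnd_cbnd; last first.
    by apply/measurable_EFinP; exact: measurable_funTS.
  rewrite [RHS]integral_mkcond; apply: eq_integral => t _.
  by rewrite patchE indicE; case: (t \in _); rewrite ?mul1r ?mul0r.
have pn : (pi : R) != 0 by rewrite lt0r_neq0// pi_gt0.
rewrite -EFinM; congr EFin.
by move: (pi : R) pn => p pn; field.
Qed.

Lemma L2_bump (A B : R) : A <= B -> L2 (bump A B).
Proof.
rewrite le_eqVlt => /predU1P[<-|AB].
  rewrite (_ : bump A A = fun=> 0); first exact: L2_0.
  by apply/funext => x; exact: bumpxx.
by split; [exact: cmeasurable_bump|rewrite sqnorm_bump// ltry].
Qed.

End BumpNorm.

(** * Bessel inequality on the Fourier side *)

Section ScalarInner.
Variable R : realType.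
Local Notation C := R[i].
Local Notation mu := (@lebesgue_measure R).
Implicit Types f g h : R -> C.

Definition ip f g : C := cintegral (fun x => f x * conjc (g x)).

(** A function seen as a vector with one component, to transfer the inner product lemmas of L^2(R)^n
    to scalar functions. *)
Let v1 f : vec R 1 := fun _ => f.

Let L2v1 f : L2 f -> L2n (v1 f). Proof. by move=> Lf i. Qed.

Let inner_v1 f g : inner (v1 f) (v1 g) = ip f g.
Proof. by rewrite /inner big_ord1. Qed.

Let sqn_v1 f : L2 f -> sqn (v1 f) = fine (sqnorm f).
Proof. by move=> Lf; rewrite /sqn inner_v1 /ip sqnorm_inner. Qed.

Lemma ipBl f g h : L2 f -> L2 g -> L2 h ->
  ip (fun x => f x - g x) h = ip f h - ip g h.
Proof.
by move=> Lf Lg Lh; rewrite -!inner_v1 -innerBl//; exact: L2v1.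
Qed.

Lemma ipC f g : L2 f -> L2 g -> ip g f = conjc (ip f g).
Proof. by move=> Lf Lg; rewrite -!inner_v1 -innerC//; exact: L2v1. Qed.

Lemma ipZl c f h : L2 f -> L2 h -> ip (fun x => c * f x) h = c * ip f h.
Proof. by move=> Lf Lh; rewrite -!inner_v1 -innerZl//; exact: L2v1. Qed.

Lemma ipZr c f h : L2 f -> L2 h -> ip h (fun x => c * f x) = conjc c * ip h f.
Proof. by move=> Lf Lh; rewrite -!inner_v1 -innerZr//; exact: L2v1. Qed.

Lemma ip_cauchy_schwarz f g : L2 f -> L2 g ->
  normc (ip f g) ^+ 2 <= fine (sqnorm f) * fine (sqnorm g).
Proof.
move=> Lf Lg; rewrite -inner_v1 -!sqn_v1//.
by apply: cauchy_schwarz; exact: L2v1.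
Qed.

Lemma ip_bessel (s : seq int) (e : int -> R -> C) f :
  L2 f -> (forall k, L2 (e k)) -> uniq s ->
  (forall a b, ip (e a) (e b) = (a == b)%:R) ->
  ((\sum_(k <- s) normc (ip f (e k)) ^+ 2)%:E <= sqnorm f)%E.
Proof.
move=> Lf Le us oe; rewrite -[leRHS]fineK; last first.
  by rewrite ge0_fin_numE ?sqnorm_ge0//; case: Lf.
rewrite lee_fin -sqn_v1//; under eq_bigr do rewrite -inner_v1.
apply: (bessel (L2v1 Lf) (fun k => L2v1 (Le k)) us) => a b _ _.
by rewrite inner_v1.
Qed.

Lemma ip_translate (s : R) f g : L2 f -> L2 g ->
  ip (fun x => f (x - s)) g = ip f (fun x => g (x + s)).
Proof.
move=> Lf Lg; rewrite /ip.
have L : L1 (fun x => f x * conjc (g (1 * x + s))).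
  by apply: L1M => //; apply: L2_conj; apply: L2_affine.
rewrite -[RHS](@eq_cintegral _ (fun x => f x * conjc (g (1 * x + s)))); last first.
  by move=> x; rewrite mul1r.
have := cintegral_affine (- s) ltr01 L; rewrite invr1 mul1r => <-.
by apply: eq_cintegral => x; rewrite !mul1r subrK.
Qed.

End ScalarInner.

(** * Pairing with translated bumps *)

Section FourierBessel.
Variable R : realType.
Local Notation C := R[i].
Local Notation mu := (@lebesgue_measure R).
Implicit Types (f g u : R -> C) (A B s : R).

Lemma cmeasurable2_kernel u A B s : cmeasurable u ->
  cmeasurable2 (fun x xi => u x * (win A B xi * expi (- ((x - s) * xi)))).
Proof.
move=> mu_; have -> : (fun x xi => u x * (win A B xi * expi (- ((x - s) * xi)))) =
    (fun x xi => (u x * (win A B xi * expi (s * xi))) * conjc (expi (x * xi))).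
  apply/funext => x; apply/funext => xi.
  by rewrite conjc_expi -!mulrA -expiD; congr (_ * (_ * expi _)); ring.
apply: cmeasurable2M.
  apply: cmeasurable2M; first exact: cmeasurable2_fst.
  apply: cmeasurable2_snd; apply: cmeasurableM; first exact: cmeasurable_win.
  by apply: cmeasurable_expi; exact: mulrl_measurable.
have [h1 h2] := cmeasurable2_expiM R; split; first by under eq_fun do rewrite Re_conj.
by under eq_fun do rewrite Im_conj; exact: measurable_funN.
Qed.

Lemma cmeasurable_fourierL1 u : cmeasurable u -> cmeasurable (fourierL1 u).
Proof.
move=> mu_; apply: (cmeasurable_cintegral
  (H := fun xi x => u x * expi (- (xi * x)))).
apply: cmeasurable2M; first exact: cmeasurable2_snd.
have [h1 h2] := cmeasurable2_expiM R; split.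
  by under eq_fun do rewrite -conjc_expi Re_conj.
by under eq_fun do rewrite -conjc_expi Im_conj; exact: measurable_funN.
Qed.

Lemma L2_bump_translate A B s : A <= B -> L2 (fun x => bump A B (x - s)).
Proof.
move=> AB; rewrite (_ : (fun _ => _) = fun x => bump A B (1 * x + - s)).
  by apply: L2_affine => //; exact: L2_bump.
by apply/funext => x; rewrite mul1r.
Qed.

Lemma L2_win_expi A B s : L2 (fun xi => win A B xi * expi (- (s * xi))).
Proof.
rewrite (_ : (fun _ => _) = fun xi => expi (- s * xi) * win A B xi).
  apply: (L2_bounded_mul (k := 1)); last exact: L2_win.
    by apply: cmeasurable_expi; exact: mulrl_measurable.
  by move=> x; rewrite normc_expi.
by apply/funext => xi; rewrite mulrC mulNr.
Qed.

(** Parseval against an indicator: the two sides are the iterated integrals of u(x) e^(-i(x-s) xi)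
    over x in R and xi in [[A, B[], whose modulus has integral (B - A) times the L^1 norm of u. *)
Lemma ip_bump_fourierL1 u A B s : A <= B -> L1 u -> L2 u ->
  ip u (fun x => bump A B (x - s)) =
  Complex (2 * pi)^-1 0 *
  ip (fourierL1 u) (fun xi => win A B xi * expi (- (s * xi))).
Proof.
move=> AB L1u L2u; have mu_ := L2u.1.
pose H x xi := u x * (win A B xi * expi (- ((x - s) * xi))).
have L1w x : L1 (fun xi => win A B xi * expi (- ((x - s) * xi))).
  rewrite (_ : (fun _ => _) = fun xi => win A B xi * expi ((- (x - s)) * xi)).
    exact: L1_win_expi.
  by apply/funext => xi; rewrite mulNr.
have L1H x : L1 (H x) by exact: L1Z.
have HE x xi : H x xi =
    (win A B xi * expi (s * xi)) * (u x * expi (- (xi * x))).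
  rewrite /H [expi (- ((x - s) * xi))](_ : _ = expi (s * xi) * expi (- (xi * x))).
    by ring.
  by rewrite -expiD; congr expi; ring.
have L1ue xi : L1 (fun x => u x * expi (- (xi * x))).
  split.
    apply: cmeasurableM => //; apply: cmeasurable_expi.
    by apply: measurable_funN; exact: mulrl_measurable.
  by under eq_integral do rewrite normcM normc_expi mulr1; case: L1u.
have L1H' xi : L1 (H^~ xi).
  rewrite (_ : H^~ xi = fun x =>
    (win A B xi * expi (s * xi)) * (u x * expi (- (xi * x)))); first exact: L1Z.
  by apply/funext => x; exact: HE.
have cb x : u x * conjc (bump A B (x - s)) =
    Complex (2 * pi)^-1 0 * cintegral (H x).
  rewrite cintegralZ// mulrCA; congr (_ * _).
  rewrite /bump conjcM [conjc (Complex _ _)](_ : _ = Complex (2 * pi)^-1 0);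
    last by rewrite /= oppr0.
  congr (_ * _); rewrite -cintegral_conj; last exact: L1_win_expi.
  by apply: eq_cintegral => xi; rewrite conjcM conjc_win conjc_expi.
have LB := L2_bump_translate s AB.
(* Up to the factor 2 pi the inner integral is the product of u and a conjugate bump, both in
   L^2. *)
have L1i : L1 (fun x => cintegral (H x)).
  have := L1Z (Complex (2 * pi) 0) (L1M L2u (L2_conj LB)).
  congr (L1 _); apply/funext => x; rewrite cb mulrA.
  rewrite [X in X * _](_ : _ = 1) ?mul1r//.
  have p0 := lt0r_neq0 (pi2_gt0 R).
  by apply: complex_eq; rewrite /= ?mulr0 ?mul0r ?subr0 ?addr0 ?divff.
rewrite /ip; under eq_cintegral do rewrite cb.
rewrite cintegralZ//; congr (_ * _); rewrite cFubini//.
- apply: eq_cintegral => xi.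
  under eq_cintegral do rewrite HE.
  rewrite cintegralZ// mulrC; congr (_ * _).
  by rewrite conjcM conjc_win conjc_expi opprK.
- exact: cmeasurable2_kernel.
- have -> : (\int[mu]_x \int[mu]_y (normc (H x y))%:E =
    \int[mu]_x ((B - A)%:E * (normc (u x))%:E))%E.
    apply: eq_integral => x _.
    under eq_integral do rewrite /H !normcM normc_expi mulr1 normc_win EFinM.
    rewrite ge0_integralZl_EFin ?normc_ge0//; last first.
      by apply/measurable_EFinP; exact: measurable_indic.
    by rewrite integral_win// muleC.
  rewrite ge0_integralZl_EFin ?subr_ge0//; last 2 first.
  + by move=> x _; rewrite lee_fin normc_ge0.
  + by apply/measurable_EFinP; exact: measurable_normc.
  by rewrite lte_mul_pinfty// ?lee_fin ?subr_ge0//; case: L1u.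
Qed.

(** Both sides are continuous for the L^2 distance by Cauchy-Schwarz, so the identity passes from
    the approximants u m to the limit. *)
Lemma ip_bump_fourier f g A B s : A <= B -> is_fourier f g ->
  ip f (fun x => bump A B (x - s)) =
  Complex (2 * pi)^-1 0 * ip g (fun xi => win A B xi * expi (- (s * xi))).
Proof.
move=> AB [Lf [Lg [u [Lu [uf ug]]]]].
set b := (fun x => bump A B _); set w := (fun xi => win A B xi * _).
set c : C := Complex (2 * pi)^-1 0.
have Lb : L2 b by exact: L2_bump_translate.
have Lw : L2 w by exact: L2_win_expi.
have p0 : 0 < (2 * pi)^-1 :> R by rewrite invr_gt0 pi2_gt0.
pose K := 2 * fine (sqnorm b) + 2 * ((2 * pi)^-1 ^+ 2 * fine (sqnorm w)).
have K0 : 0 <= K.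
  by apply: addr_ge0; apply: mulr_ge0 => //; [|apply: mulr_ge0;
    [exact: sqr_ge0|]]; rewrite fine_ge0// sqnorm_ge0.
suff H (e : R) : 0 < e -> normc (ip f b - c * ip g w) ^+ 2 <= K * e.
  apply/eqP; rewrite -subr_eq0; apply/eqP/eq0_normc/eqP.
  rewrite -sqrf_eq0 eq_le sqr_ge0 andbT; apply/ler_addgt0Pl => e e0.
  rewrite addr0; apply: le_trans (H (e / (K + 1)) _) _.
    by rewrite divr_gt0// ltr_wpDl.
  rewrite mulrA ler_pdivrMr ?ltr_wpDl//.
  by rewrite mulrC ler_wpM2l ?(ltW e0)// lerDl.
move=> e0; have e0' : (0 < e%:E)%E by rewrite lte_fin.
have near_lt (a : nat -> \bar R) : a @ \oo --> 0%E ->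
    \forall m \near \oo, (a m < e%:E)%E.
  by move=> a0; apply: (a0 [set x | x < e%:E]%E); exact: open_ereal_lt'.
near \oo => m.
have um : (sqnorm (fun x => u m x - f x)%R < e%:E)%E by near: m; exact: near_lt.
have vm : (sqnorm (fun xi => fourierL1 (u m) xi - g xi)%R < e%:E)%E.
  by near: m; exact: near_lt.
have [L1u L2u] := Lu m.
have Luf : L2 (fun x => u m x - f x) by exact: L2B.
(* That [fourierL1 (u m)] is square integrable is not known beforehand; it follows from its finite
   distance to g. *)
have Lvg : L2 (fun x => fourierL1 (u m) x - g x).
  split; last by rewrite (lt_le_trans vm) ?leey.
  apply: cmeasurableD; first by apply: cmeasurable_fourierL1; case: L2u.
  by case: (L2N Lg).
have Lv : L2 (fourierL1 (u m)).
  have := L2D Lvg Lg; congr (L2 _); apply/funext => x; exact: subrK.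
have -> : ip f b - c * ip g w =
    c * ip (fun x => fourierL1 (u m) x - g x) w - ip (fun x => u m x - f x) b.
  rewrite !ipBl// (ip_bump_fourierL1 s AB L1u L2u) -/w -/c; ring.
apply: le_trans (sqr_normcD _ _) _; rewrite normcN normcM exprMn.
have fe h : L2 h -> (sqnorm h < e%:E)%E -> fine (sqnorm h) <= e.
  move=> [_ Lh] he; rewrite -lee_fin fineK ?ltW//.
  by rewrite ge0_fin_numE ?sqnorm_ge0.
have h1 : normc (ip (fun x => u m x - f x) b) ^+ 2 <= e * fine (sqnorm b).
  apply: le_trans (ip_cauchy_schwarz Luf Lb) _.
  by rewrite ler_wpM2r ?fine_ge0 ?sqnorm_ge0// fe.
have h2 : normc (ip (fun x => fourierL1 (u m) x - g x) w) ^+ 2 <=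
    e * fine (sqnorm w).
  apply: le_trans (ip_cauchy_schwarz Lvg Lw) _.
  by rewrite ler_wpM2r ?fine_ge0 ?sqnorm_ge0// fe.
have h3 := ler_wpM2l (sqr_ge0 (2 * pi)^-1) h2.
rewrite /K normc_real (ger0_norm (ltW p0)).
move: (2 * pi)^-1 h1 h3 => p; lra.
Unshelve. all: by end_near. Qed.

Lemma sqnorm_win_mul A B g : cmeasurable g ->
  sqnorm (fun xi => win A B xi * g xi) =
  (\int[mu]_(xi in `[A, B[) (normc (g xi) ^+ 2)%:E)%E.
Proof.
move=> mg; rewrite [RHS]integral_mkcond; apply: eq_integral => x _.
rewrite patchE normcM exprMn sqr_normc_win indicE.
by case: (x \in _); rewrite ?mul1r ?mul0r.
Qed.

Lemma L2_win_mul A B g : L2 g -> L2 (fun xi => win A B xi * g xi).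
Proof.
move=> Lg; apply: (L2_bounded_mul (k := 1)) => //; first exact: cmeasurable_win.
by move=> x; rewrite normc_win indicE; case: (_ \in _).
Qed.

(** The pairings are, up to a constant, Fourier coefficients of g cut down to [[A, B[], taken on the
    full interval [[A, A + 2 pi[]. Of the two factors (2 pi)^-1 in the squared pairing, one
    normalizes the exponentials and the other remains. *)
Lemma fourier_bessel f g A B (s : seq int) :
  A <= B -> B <= A + 2 * pi -> is_fourier f g -> uniq s ->
  ((\sum_(k <- s) normc (ip f (fun x => bump A B (x - k%:~R))) ^+ 2)%:E <=
   (2 * pi)^-1%:E * \int[mu]_(xi in `[A, B[) (normc (g xi) ^+ 2)%:E)%E.
Proof.
move=> AB BA fg us; have [Lf [Lg _]] := fg.
have p0 : 0 < (2 * pi)^-1 :> R by rewrite invr_gt0 pi2_gt0.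
have [q q2] : exists q : R, q ^+ 2 = (2 * pi)^-1.
  by exists (Num.sqrt (2 * pi)^-1); rewrite sqr_sqrtr// ltW.
pose w (k : int) xi : C := win A (A + 2 * pi) xi * expi (- (k%:~R * xi)).
pose e (k : int) xi : C := Complex q 0 * w k xi.
have Lw k : L2 (w k) by exact: L2_win_expi.
have Le k : L2 (e k) by exact: L2Z.
have cq : conjc (Complex q 0) = Complex q 0 by rewrite /= oppr0.
have oe a b : ip (e a) (e b) = (a == b)%:R.
  rewrite ipZl// ipZr// cq mulrA.
  rewrite (_ : Complex q 0 * Complex q 0 = Complex (2 * pi)^-1 0); last first.
    by rewrite -q2; apply: complex_eq => /=; ring.
  rewrite -[RHS](_ : bump A (A + 2 * pi) (b - a)%:~R = _); last first.
    by rewrite bump_int subr_eq0 eq_sym.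
  rewrite /bump; congr (_ * _); apply: eq_cintegral => xi.
  rewrite /w conjcM conjc_win conjc_expi mulrACA winM -expiD intrB.
  by congr (_ * expi _); ring.
have key k : normc (ip f (fun x => bump A B (x - k%:~R))) ^+ 2 =
    (2 * pi)^-1 * normc (ip (fun xi => win A B xi * g xi) (e k)) ^+ 2.
  rewrite (ip_bump_fourier _ AB fg) ipZr//; last exact: L2_win_mul.
  rewrite cq !normcM !normc_real !exprMn !real_normK ?num_real// q2.
  rewrite [RHS]mulrA -[X in _ = X * _]expr2; congr (_ * normc _ ^+ 2); apply: eq_cintegral => xi.
  rewrite /w !conjcM !conjc_win; set c := conjc (expi _).
  have W : win A B xi * win A (A + 2 * pi) xi = win A B xi.
    rewrite /win; case: ifPn => [/andP[Axi xiB]|_]; last by rewrite mul0r.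
    by rewrite Axi (lt_le_trans xiB BA) mulr1.
  transitivity ((win A B xi * win A (A + 2 * pi) xi) * (g xi * c)).
    by rewrite W mulrCA.
  by rewrite mulrACA.
under eq_bigr do rewrite key.
rewrite -mulr_sumr EFinM -sqnorm_win_mul; last by case: Lg.
rewrite lee_pmul2l ?lte_fin//.
by apply: ip_bessel => //; exact: L2_win_mul.
Qed.

End FourierBessel.

(** * Lower bound for the dimension function *)

Section FrameEstimates.
Variables (R : realType) (N n : nat) (sigma : {perm 'I_n}).
Variable theta : 'I_n -> R.
Hypothesis N_gt0 : (0 < N)%N.
Local Notation C := R[i].
Local Notation mu := (@lebesgue_measure R).
Local Notation T := (Tpow theta).
Implicit Types (i : 'I_n) (f g : vec R n) (a A B : R).

Let N0 : 0 < N%:R :> R. Proof. by rewrite ltr0n. Qed.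

Lemma inner_singlel i (u : R -> C) g : inner (single i u) g = ip u (g i).
Proof.
rewrite /inner (bigD1 i)//= big1 ?addr0.
  by apply: eq_cintegral => x; rewrite /single eqxx.
move=> j /negbTE ji; rewrite -[RHS](cintegral0 R); apply: eq_cintegral => x.
by rewrite /single ji mul0r.
Qed.

(** On a single component T^k is a translation times a unimodular constant, invisible in the
    modulus. Shifting the other factor instead reverses the sign of k. *)
Lemma sqr_normc_inner_Tpow i (u : R -> C) g k : L2 u -> L2n g ->
  normc (inner (single i u) (T k g)) ^+ 2 =
  normc (ip (g i) (fun x => u (x - (- k)%:~R))) ^+ 2.
Proof.
move=> Lu Lg; rewrite inner_singlel.
have -> : T k g i = fun x => expi (- (k%:~R * theta i)) * g i (x - k%:~R).
  by apply/funext => x; rewrite TpowE.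
have Lgk : L2 (fun x => g i (x - k%:~R)).
  rewrite (_ : (fun _ => _) = fun x => g i (1 * x + - k%:~R)).
    exact: L2_affine.
  by apply/funext => x; rewrite mul1r.
rewrite ipZr// normcM normc_conj normc_expi mul1r.
rewrite (ipC Lgk Lu) normc_conj ip_translate//.
by congr (normc (ip _ _) ^+ 2); apply/funext => x; rewrite mulrNz opprK.
Qed.

Section OneFunction.
Variables (g gh : vec R n).
Hypothesis gF : forall i, is_fourier (g i) (gh i).

Let Lg : L2n g. Proof. by move=> i; case: (gF i). Qed.
Let Lgh i : L2 (gh i). Proof. by case: (gF i) => _ []. Qed.

Let mgh i (D : set R) : measurable_fun D (fun xi => (normc (gh i xi) ^+ 2)%:E).
Proof. by apply: measurable_funTS; apply: measurable_esqr_normc; case: (Lgh i). Qed.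

Lemma short_bump_bound i (c A B : R) (s : seq int) :
  A <= B -> B <= A + 2 * pi -> uniq s ->
  ((\sum_(k <- s) normc (inner
      (single i (fun x => Complex c 0 * bump A B x)) (T k g)) ^+ 2)%:E <=
   (c ^+ 2 * (2 * pi)^-1)%:E *
   \int[mu]_(xi in `[A, B[) (normc (gh i xi) ^+ 2)%:E)%E.
Proof.
move=> AB BA us; have Lb := L2_bump AB.
have -> : \sum_(k <- s) normc (inner
      (single i (fun x => Complex c 0 * bump A B x)) (T k g)) ^+ 2 =
    c ^+ 2 * \sum_(k <- [seq - k | k <- s])
      normc (ip (g i) (fun x => bump A B (x - k%:~R))) ^+ 2.
  rewrite mulr_sumr big_map; apply: eq_bigr => k _.
  rewrite sqr_normc_inner_Tpow//; last exact: L2Z.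
  rewrite (ipZr (Complex c 0) (L2_bump_translate (- k)%:~R AB) (Lg i)).
  by rewrite normcM exprMn normc_conj normc_real real_normK ?num_real.
rewrite EFinM [(_ * (2 * pi)^-1)%:E]EFinM -[leRHS]muleA; apply: lee_wpmul2l; first by rewrite lee_fin sqr_ge0.
by apply: fourier_bessel => //; rewrite map_inj_uniq//; exact: oppr_inj.
Qed.

Lemma sqr_normc_sum (F : nat -> C) (M : nat) :
  normc (\sum_(0 <= q < M) F q) ^+ 2 <= M%:R * \sum_(0 <= q < M) normc (F q) ^+ 2.
Proof.
elim: M => [|M IH]; first by rewrite !big_geq// normc0 expr0n mul0r.
rewrite !big_nat_recr//=; set S := \sum_(0 <= i < M) _ in IH *.
set P := \sum_(0 <= i < M) _ in IH *.
have P0 : 0 <= P by apply: sumr_ge0 => ? _; exact: sqr_ge0.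
apply: (@le_trans _ _ ((normc S + normc (F M)) ^+ 2)).
  by rewrite ler_sqr ?nnegrE ?addr_ge0 ?normc_ge0// normc_leD.
have [M0|M0] := posnP M.
  by rewrite /S M0 big_geq// normc0 add0r mul1r lerDr.
have M0' : 0 < M%:R :> R by rewrite ltr0n.
rewrite -natr1 sqrrD.
have : 0 <= (normc S - M%:R * normc (F M)) ^+ 2 by exact: sqr_ge0.
move: IH P0; move: (normc S) (normc (F M)) => x y IH P0 H.
rewrite -(ler_pM2l M0'); nra.
Qed.

(** Bessel needs intervals of length at most 2 pi, so the long one is cut into M such pieces;
    Cauchy-Schwarz over the pieces costs the factor M. *)
Lemma long_bump_bound i (c A : R) (M : nat) (s : seq int) : uniq s ->
  ((\sum_(k <- s) normc (inner
      (single i (fun x => Complex c 0 * bump A (A + 2 * pi * M%:R) x)) (T k g)) ^+ 2)%:E <=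
   (c ^+ 2 * M%:R * (2 * pi)^-1)%:E *
   \int[mu]_(xi in `[A, (A + 2 * pi * M%:R)%R[) (normc (gh i xi) ^+ 2)%:E)%E.
Proof.
move=> us; pose P (q : nat) : R := A + 2 * pi * q%:R.
have PS q : P q.+1 = P q + 2 * pi by rewrite /P -natr1; ring.
have p0 := pi2_gt0 R.
have PP q : P q <= P q.+1 by rewrite PS lerDl ltW.
have P0 q : P 0 <= P q by rewrite /P lerD2l mulr0 mulr_ge0// ltW.
have -> : A = P 0 by rewrite /P mulr0 addr0.
have -> : P 0 + 2 * pi * M%:R = P M by rewrite /P mulr0 addr0.
have bumpE x : bump (P 0) (P M) x = \sum_(0 <= q < M) bump (P q) (P q.+1) x.
  elim: M => [|M IH]; last by rewrite big_nat_recr//= -IH (bumpD x (P0 M) (PP M)).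
  by rewrite big_geq// bumpxx.
have intE : (\int[mu]_(xi in `[P 0%N, P M[) (normc (gh i xi) ^+ 2)%:E =
    \sum_(0 <= q < M) \int[mu]_(xi in `[P q, P q.+1[) (normc (gh i xi) ^+ 2)%:E)%E.
  elim: {bumpE} M => [|M IH].
    by rewrite big_geq// set_itvco0 integral_set0.
  rewrite big_nat_recr//= -IH.
  have -> : `[P 0%N, P M.+1[%classic = `[P 0%N, P M[ `|` `[P M, P M.+1[ :> set R.
    by apply: itv_bndbnd_setU; rewrite bnd_simp.
  rewrite ge0_integral_setU//; [exact: mgh|by move=> x _; rewrite lee_fin sqr_ge0|].
  apply/disj_setPS => x [] /=; rewrite !in_itv/= => /andP[_ xM] /andP[Mx _].
  by rewrite ltNge Mx in xM.
have Lq q : L2 (fun x => Complex c 0 * bump (P q) (P q.+1) x).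
  by apply: L2Z; exact: L2_bump.
have E k : inner (single i (fun x => Complex c 0 * bump (P 0) (P M) x)) (T k g) =
    \sum_(0 <= q < M) inner
      (single i (fun x => Complex c 0 * bump (P q) (P q.+1) x)) (T k g).
  have -> : single i (fun x => Complex c 0 * bump (P 0) (P M) x) =
      fun j x => \sum_(q <- index_iota 0 M) 1 *
        single i (fun x => Complex c 0 * bump (P q) (P q.+1) x) j x.
    apply/funext => j; apply/funext => x; under eq_bigr do rewrite mul1r.
    by rewrite /single; case: eqP => _; [rewrite bumpE mulr_sumr|rewrite big1].
  rewrite inner_lincombl; [|by move=> q; exact: L2n_single|exact: L2n_Tpow].
  by apply: eq_bigr => q _; rewrite mul1r.
apply: (@le_trans _ _ (M%:R * \sum_(0 <= q < M) \sum_(k <- s) normc (inner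
      (single i (fun x => Complex c 0 * bump (P q) (P q.+1) x)) (T k g)) ^+ 2)%:E).
  rewrite lee_fin exchange_big mulr_sumr; apply: ler_sum => k _.
  by rewrite E; exact: sqr_normc_sum.
rewrite EFinM -sumEFin mulrAC [_ * M%:R]mulrC EFinM -muleA.
apply: lee_wpmul2l; first by rewrite lee_fin.
rewrite intE ge0_sume_distrr; last first.
  by move=> q _; apply: integral_ge0 => x _; rewrite lee_fin sqr_ge0.
have PB q : P q.+1 <= P q + 2 * pi by rewrite PS.
by apply: lee_sum => q _; exact: short_bump_bound (PP q) (PB q) us.
Qed.

Lemma iter_opU_bump l i A B :
  iter l (opU N sigma) (single i (bump A B)) =
  single ((sigma^-1 ^+ l)%g i) (fun x => Complex (Num.sqrt N%:R ^+ l) 0 *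
    bump (A / N%:R ^+ l) (B / N%:R ^+ l) x).
Proof.
apply/funext => j; apply/funext => x; rewrite iter_opUE /single.
have Nl : 0 < N%:R ^+ l :> R by rewrite exprn_gt0.
rewrite expVgn -(can2_eq (permK _) (permKV _)).
case: eqP => _; last by rewrite mulr0.
rewrite bump_scale// mulrA; congr (_ * _).
have s0 : Num.sqrt N%:R != 0 :> R by rewrite gt_eqF// sqrtr_gt0.
have -> : N%:R ^+ l = Num.sqrt N%:R ^+ l * Num.sqrt N%:R ^+ l :> R.
  by rewrite -exprMn -expr2 sqr_sqrtr// ltW.
apply: complex_eq => /=; last by rewrite mulr0 mul0r addr0.
by rewrite mulr0 subr0 exprVn mulKf// expf_neq0.
Qed.

Lemma iter_opUinv_bump m i A B :
  iter m (opUinv N sigma) (single i (bump A B)) =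
  single ((sigma ^+ m)%g i) (fun x => Complex ((Num.sqrt N%:R)^-1 ^+ m) 0 *
    bump (A * N%:R ^+ m) (B * N%:R ^+ m) x).
Proof.
apply/funext => j; apply/funext => x; rewrite iter_opUinvE /single.
have Nm : 0 < N%:R ^+ m :> R by rewrite exprn_gt0.
rewrite -(can2_eq (permKV _) (permK _)) -expVgn.
case: eqP => _; last by rewrite mulr0.
have Nm' : 0 < (N%:R ^+ m)^-1 :> R by rewrite invr_gt0.
have := bump_scale A B x Nm'; rewrite !invrK => ->; rewrite mulrA; congr (_ * _).
have s0 : Num.sqrt N%:R != 0 :> R by rewrite gt_eqF// sqrtr_gt0.
have -> : N%:R ^+ m = Num.sqrt N%:R ^+ m * Num.sqrt N%:R ^+ m :> R.
  by rewrite -exprMn -expr2 sqr_sqrtr// ltW.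
apply: complex_eq => /=; last by rewrite mulr0 mul0r addr0.
by rewrite mulr0 subr0 exprVn invfM mulrA divff ?mul1r// expf_neq0.
Qed.

Lemma Upow_oppz (l : nat) f : Upow N sigma (- l%:Z) f = iter l (opUinv N sigma) f.
Proof. by case: l => [|l]. Qed.

(** Moving U^-l to the other factor shrinks the frequency interval by N^l, to length at most 2 pi.
    The factor N^l from the normalization is absorbed by the change of variable back to [[a, a + 2
    pi[]. *)
Lemma coarse_level_bound i (a : R) (l : nat) (s : seq int) : uniq s ->
  ((\sum_(k <- s) normc (inner (single i (bump a (a + 2 * pi)))
     (Upow N sigma (- l%:Z) (T k g))) ^+ 2)%:E <=
   (2 * pi)^-1%:E * \int[mu]_(xi in `[a, (a + 2 * pi)%R[)
     (normc (gh ((sigma^-1 ^+ l)%g i) (xi / N%:R ^+ l)) ^+ 2)%:E)%E.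
Proof.
move=> us; set b := a + 2 * pi; set i' := (sigma^-1 ^+ l)%g i.
have ab : a <= b by rewrite lerDl ltW// pi2_gt0.
have Nl : 0 < N%:R ^+ l :> R by rewrite exprn_gt0.
have Nl1 : 1 <= N%:R ^+ l :> R by rewrite exprn_ege1// ler1n.
have LB : L2n (single i (bump a b)) by apply: L2n_single; exact: L2_bump.
have -> : \sum_(k <- s) normc (inner (single i (bump a b))
     (Upow N sigma (- l%:Z) (T k g))) ^+ 2 =
   \sum_(k <- s) normc (inner (single i' (fun x => Complex (Num.sqrt N%:R ^+ l) 0 *
    bump (a / N%:R ^+ l) (b / N%:R ^+ l) x)) (T k g)) ^+ 2.
  apply: eq_bigr => k _; rewrite -iter_opU_bump Upow_oppz.
  have LT : L2n (T k g) by exact: L2n_Tpow.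
  rewrite -[in RHS](iter_opUinvK sigma N_gt0 l (T k g)) inner_iter//.
  - by move=> ?; exact: L2n_opU.
  - by move=> ? ?; exact: inner_opU.
  - by apply: L2n_iter => // ?; exact: L2n_opUinv.
have ab' : a / N%:R ^+ l <= b / N%:R ^+ l by rewrite ler_pM2r// invr_gt0.
have ba' : b / N%:R ^+ l <= a / N%:R ^+ l + 2 * pi.
  rewrite /b mulrDl lerD2l; apply: ler_piMr; first exact: ltW (pi2_gt0 R).
  by rewrite invf_le1.
apply: le_trans (short_bump_bound i' (Num.sqrt N%:R ^+ l) ab' ba' us) _.
have -> : (Num.sqrt N%:R ^+ l) ^+ 2 * (2 * pi)^-1 = (2 * pi)^-1 * N%:R ^+ l :> R.
  by rewrite -exprM mulnC exprM sqr_sqrtr ?(ltW N0)// mulrC.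
rewrite [((2 * pi)^-1 * _)%:E]EFinM -[leLHS]muleA.
apply: lee_wpmul2l; first by rewrite lee_fin invr_ge0 ltW// pi2_gt0.
rewrite -sqnorm_win_mul; last by case: (Lgh i').
pose h (xi : R) := win (a / N%:R ^+ l) (b / N%:R ^+ l) xi * gh i' xi.
have mh : cmeasurable h.
  by apply: cmeasurableM; [exact: cmeasurable_win|case: (Lgh i')].
have Nl' : 0 < (N%:R ^+ l)^-1 :> R by rewrite invr_gt0.
have := sqnorm_affine 0 Nl' mh; rewrite invrK => <-.
rewrite -sqnorm_win_mul; last first.
  rewrite (_ : (fun _ => _) = fun xi => gh i' ((N%:R ^+ l)^-1 * xi + 0)).
    by apply: cmeasurable_affine; case: (Lgh i').
  by apply/funext => xi; rewrite addr0 mulrC.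
rewrite le_eqVlt; apply/orP; left; apply/eqP; congr sqnorm; apply/funext => xi.
rewrite /h addr0 win_scale// invrK !mulfVK ?lt0r_neq0//.
by rewrite [_ * xi]mulrC.
Qed.

(** Here the interval grows to length 2 pi N^m; the factor N^m lost in [long_bump_bound] is
    cancelled by the squared normalization N^-m. *)
Lemma fine_level_bound i (a : R) (m : nat) (s : seq int) : uniq s ->
  ((\sum_(k <- s) normc (inner (single i (bump a (a + 2 * pi)))
     (Upow N sigma m%:Z (T k g))) ^+ 2)%:E <=
   (2 * pi)^-1%:E *
   \int[mu]_(xi in `[(a * N%:R ^+ m)%R, ((a + 2 * pi) * N%:R ^+ m)%R[)
     (normc (gh ((sigma ^+ m)%g i) xi) ^+ 2)%:E)%E.
Proof.
move=> us; set b := a + 2 * pi; set i' := (sigma ^+ m)%g i.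
have ab : a <= b by rewrite lerDl ltW// pi2_gt0.
have Nm : 0 < N%:R ^+ m :> R by rewrite exprn_gt0.
have LB : L2n (single i (bump a b)) by apply: L2n_single; exact: L2_bump.
have bE : b * N%:R ^+ m = a * N%:R ^+ m + 2 * pi * (N ^ m)%:R.
  by rewrite natrX /b mulrDl.
have -> : \sum_(k <- s) normc (inner (single i (bump a b))
     (Upow N sigma m%:Z (T k g))) ^+ 2 =
   \sum_(k <- s) normc (inner (single i' (fun x => Complex ((Num.sqrt N%:R)^-1 ^+ m) 0 *
    bump (a * N%:R ^+ m) (a * N%:R ^+ m + 2 * pi * (N ^ m)%:R) x)) (T k g)) ^+ 2.
  apply: eq_bigr => k _; rewrite -bE -iter_opUinv_bump.
  rewrite -[Upow _ _ _ _]/(iter m (opU N sigma) (T k g)).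
  have LT : L2n (T k g) by exact: L2n_Tpow.
  rewrite -[in RHS](iter_opUK sigma N_gt0 m (T k g)) inner_iter//.
  - by move=> ?; exact: L2n_opUinv.
  - by move=> ? ?; exact: inner_opUinv.
  - by apply: L2n_iter => // ?; exact: L2n_opU.
apply: le_trans (long_bump_bound i' _ _ _ us) _.
have -> : ((Num.sqrt N%:R)^-1 ^+ m) ^+ 2 * (N ^ m)%:R = 1 :> R.
  rewrite natrX exprVn exprVn -exprM mulnC exprM sqr_sqrtr ?(ltW N0)//.
  by rewrite mulVf// lt0r_neq0.
by rewrite mul1r -bE.
Qed.

End OneFunction.

Section Frame.
Variables (r : nat) (Psi Psihat : 'I_r -> vec R n).
Hypothesis PsiF : forall p i, is_fourier (Psi p i) (Psihat p i).
Hypothesis tight : normalized_tight_frame (affine_system N sigma theta Psi).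

(** The bound of [coarse_level_bound] summed over the generators: the mean over [[a, a + 2 pi[] of
    the term l of the Calderon sum. Level 0 of the affine system is counted here, as l = 0. *)
Definition coarse_energy (a : R) i (l : nat) : \bar R :=
  (\sum_(p < r) ((2 * pi)^-1%:E * \int[mu]_(xi in `[a, (a + 2 * pi)%R[)
     (normc (Psihat p ((sigma^-1 ^+ l)%g i) (xi / N%:R ^+ l)) ^+ 2)%:E))%E.

Definition fine_energy (a : R) i (m : nat) : \bar R :=
  (\sum_(p < r) ((2 * pi)^-1%:E *
   \int[mu]_(xi in `[(a * N%:R ^+ m)%R, ((a + 2 * pi) * N%:R ^+ m)%R[)
     (normc (Psihat p ((sigma ^+ m)%g i) xi) ^+ 2)%:E))%E.

Lemma ler_sum_subseq (I : eqType) (s t : seq I) (w : I -> R) :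
  uniq s -> uniq t -> {subset s <= t} -> (forall x, 0 <= w x) ->
  \sum_(x <- s) w x <= \sum_(x <- t) w x.
Proof.
move=> us ut st w0; rewrite [leRHS](bigID (fun x => x \in s))/= -[X in _ <= X + _]big_filter.
have ps : perm_eq (seq.filter (fun x => x \in s) t) s.
  apply: uniq_perm; [exact: filter_uniq|by []|move=> x; rewrite mem_filter].
  by case: (boolP (x \in s)) => // /st ->.
by rewrite (perm_big _ ps) lerDl; apply: sumr_ge0.
Qed.

Lemma sqnormn_single_bump i (a : R) :
  sqnormn (single i (bump a (a + 2 * pi))) = 1%E.
Proof.
rewrite /sqnormn (bigD1 i)//= big1 ?adde0; last first.
  move=> j /negbTE ji; rewrite /sqnorm integral0_eq// => x _.
  by rewrite /single ji normc0 expr0n.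
have -> : single i (bump a (a + 2 * pi)) i = bump a (a + 2 * pi).
  by apply/funext => x; rewrite /single eqxx.
rewrite sqnorm_bump ?ltrDl ?pi2_gt0//; congr EFin.
by rewrite addrAC subrr add0r divff// lt0r_neq0// pi2_gt0.
Qed.

Lemma frame_lower_bound i (a eta : R) : 0 < eta ->
  exists L0 : nat, forall L : nat, (L0 <= L)%N ->
  ((1 - eta)%:E <= \sum_(0 <= l < L) coarse_energy a i l +
     \sum_(1 <= m < L) fine_energy a i m)%E.
Proof.
move=> eta0; set f := single i (bump a (a + 2 * pi)).
have Lf : L2n f.
  by apply: L2n_single; apply: L2_bump; rewrite lerDl ltW// pi2_gt0.
have e1 : ((1 - eta)%:E < \esum_(x in [set: int * int * 'I_r])
    ((normc (inner f (affine_system N sigma theta Psi x))) ^+ 2)%:E)%E.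
  by rewrite tight// sqnormn_single_bump lte_fin ltrBlDr ltrDl.
(* The frame sum is a supremum over finite index sets, so one of them already exceeds 1 - eta. *)
have [_ [F [finF _] <-] /ltW eF] := ereal_sup_gt e1.
move: eF; rewrite fsbig_finite//= sumEFin; set s := (X in \sum_(x <- X) _).
have us : uniq s by exact: finmap.fset_uniq.
pose w x := normc (inner f (affine_system N sigma theta Psi x)) ^+ 2.
rewrite -/(w _) => eF; exists (\sum_(x <- s) `|x.1.1|%N).+1 => L L0.
pose K := undup [seq x.1.2 | x <- s].
(* All levels from -(L - 1) to L - 1, the nonpositive ones first; the finite set is enlarged to a
   product so that the sum over translations is innermost. *)
pose J : seq int := [seq - l%:Z | l <- iota 0 L] ++ [seq m%:Z | m <- iota 1 L.-1].
pose t := [seq (jk, p) | jk <- [seq (j, k) | j <- J, k <- K],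
                         p <- index_enum 'I_r].
have uJ : uniq J.
  have i1 : injective (fun l : nat => - l%:Z) by move=> x y; lia.
  have i2 : injective (fun m : nat => m%:Z) by move=> x y; lia.
  rewrite cat_uniq (map_inj_uniq i1) (map_inj_uniq i2) !iota_uniq/= andbT.
  apply/hasPn => _ /mapP[m + ->]; rewrite mem_iota => /andP[m1 _].
  by apply/mapP => -[l _]; lia.
have ut : uniq t.
  apply: allpairs_uniq; [|exact: index_enum_uniq|by move=> [? ?] [? ?] _ _].
  by apply: allpairs_uniq; [exact: uJ|exact: undup_uniq|move=> [? ?] [? ?] _ _].
have st : {subset s <= t}.
  move=> [[j k] p] xs; apply/allpairsP; exists ((j, k), p); split => //=; last first.
    by rewrite mem_index_enum.
  apply/allpairsP; exists (j, k); split => //=; last first.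
    by rewrite mem_undup; apply/mapP; exists (j, k, p).
  have jL : (`|j| < L)%N.
    apply: leq_trans L0; rewrite ltnS (bigD1_seq (j, k, p))//=.
    exact: leq_addr.
  rewrite mem_cat; case: (lerP j 0) => j0.
    apply/orP; left; apply/mapP; exists `|j|%N; last by lia.
    by rewrite mem_iota.
  apply/orP; right; apply/mapP; exists `|j|%N; last by lia.
  by rewrite mem_iota; lia.
have w0 x : 0 <= w x by exact: sqr_ge0.
have wst : \sum_(x <- s) w x <= \sum_(x <- t) w x by exact: ler_sum_subseq.
apply: (@le_trans _ _ (\sum_(x <- t) w x)%:E); first exact: le_trans wst.
have tE : \sum_(x <- t) w x =
    \sum_(0 <= l < L) \sum_(p < r) \sum_(k <- K) w (- l%:Z, k, p) +
    \sum_(1 <= m < L) \sum_(p < r) \sum_(k <- K) w (m%:Z, k, p).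
  rewrite big_allpairs big_allpairs big_cat !big_map.
  rewrite /index_iota subn0 subn1; congr (_ + _);
    by apply: eq_bigr => l _; rewrite exchange_big.
rewrite tE EFinD -!sumEFin; apply: leeD; apply: lee_sum => l _.
  rewrite -sumEFin; apply: lee_sum => p _.
  exact: (@coarse_level_bound _ (Psihat p) (PsiF p) i a l K (undup_uniq _)).
rewrite -sumEFin; apply: lee_sum => p _.
exact: (@fine_level_bound _ (Psihat p) (PsiF p) i a l K (undup_uniq _)).
Qed.

End Frame.
End FrameEstimates.

(** * Smallness of the fine levels *)

Section DimensionFunction.
Variables (R : realType) (N n : nat) (sigma : {perm 'I_n}).
Variable theta : 'I_n -> R.
Hypothesis hN : (2 <= N)%N.
Variables (r : nat) (Psi Psihat : 'I_r -> vec R n).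
Hypothesis PsiF : forall p i, is_fourier (Psi p i) (Psihat p i).
Local Notation mu := (@lebesgue_measure R).
Local Notation coarse := (coarse_energy N sigma Psihat).
Local Notation fine_en := (fine_energy N sigma Psihat).
Implicit Types (i : 'I_n) (a : R).

Let N_gt0 : (0 < N)%N. Proof. exact: ltnW. Qed.
Let N0 : 0 < N%:R :> R. Proof. by rewrite ltr0n. Qed.
Let p0 := pi2_gt0 R.

(** Summing over all components makes the majorant independent of sigma^m(i), so the fine levels
    over disjoint intervals combine into one integral. *)
Definition total_density (xi : R) : R :=
  \sum_(p < r) \sum_(i < n) normc (Psihat p i xi) ^+ 2.

Let mPsihat p i : cmeasurable (Psihat p i).
Proof. by case: (PsiF p i) => _ [[]]. Qed.

Let mdens p i (D : set R) :
  measurable_fun D (fun xi : R => (normc (Psihat p i xi) ^+ 2)%:E).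
Proof. by apply: measurable_funTS; exact: measurable_esqr_normc. Qed.

Lemma total_density_ge0 xi : 0 <= total_density xi.
Proof. by apply: sumr_ge0 => p _; apply: sumr_ge0 => i _; exact: sqr_ge0. Qed.

Let total_densityE xi : ((total_density xi)%:E =
  \sum_(p < r) \sum_(i < n) (normc (Psihat p i xi) ^+ 2)%:E)%E.
Proof. by rewrite /total_density -sumEFin; apply: eq_bigr => p _; rewrite sumEFin. Qed.

Lemma measurable_total_density (D : set R) :
  measurable_fun D (fun xi : R => (total_density xi)%:E).
Proof.
under eq_fun do rewrite total_densityE.
by apply: emeasurable_sum => p; apply: emeasurable_sum => i; exact: mdens.
Qed.

Lemma integral_total_density_lty : (\int[mu]_xi (total_density xi)%:E < +oo)%E.
Proof.
under eq_integral do rewrite total_densityE.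
rewrite ge0_integral_sum//; last 2 first.
- by move=> p; apply: emeasurable_sum => i; exact: mdens.
- by move=> p x _; apply: sume_ge0 => i _; rewrite lee_fin sqr_ge0.
apply: lte_sum_pinfty => p _; rewrite ge0_integral_sum//; last 2 first.
- by move=> i; exact: mdens.
- by move=> i x _; rewrite lee_fin sqr_ge0.
by apply: lte_sum_pinfty => i _; case: (PsiF p i) => _ [[]].
Qed.

Lemma fine_energy_le a i m : (fine_en a i m <= (2 * pi)^-1%:E *
  \int[mu]_(xi in `[(a * N%:R ^+ m)%R, ((a + 2 * pi) * N%:R ^+ m)%R[)
     (total_density xi)%:E)%E.
Proof.
rewrite /fine_energy -ge0_sume_distrr; last first.
  by move=> p _; apply: integral_ge0 => x _; rewrite lee_fin sqr_ge0.
apply: lee_wpmul2l; first by rewrite lee_fin invr_ge0 ltW.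
rewrite -ge0_integral_sum//; last 2 first.
- by move=> p; exact: mdens.
- by move=> p x _; rewrite lee_fin sqr_ge0.
apply: ge0_le_integral => //.
- by move=> x _; apply: sume_ge0 => p _; rewrite lee_fin sqr_ge0.
- by apply: emeasurable_sum => p; exact: mdens.
- exact: measurable_total_density.
- move=> x _; rewrite total_densityE; apply: lee_sum => p _.
  rewrite (bigD1 ((sigma ^+ m)%g i))//= leeDl//.
  by apply: sume_ge0 => j _; rewrite lee_fin sqr_ge0.
Qed.

(* For [2 pi <= a] the dilated intervals [a N^m, (a + 2 pi) N^m[ are pairwise
   disjoint. *)
Lemma fine_energy_sum_le a i (L : nat) : 2 * pi <= a ->
  (\sum_(1 <= m < L) fine_en a i m <=
   (2 * pi)^-1%:E * \int[mu]_(xi in `[a, +oo[) (total_density xi)%:E)%E.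
Proof.
move=> ha; set b := a + 2 * pi.
have a0 : 0 < a by exact: lt_le_trans ha.
have key (M : nat) : (\sum_(1 <= m < M.+1)
     \int[mu]_(xi in `[(a * N%:R ^+ m)%R, (b * N%:R ^+ m)%R[) (total_density xi)%:E
   <= \int[mu]_(xi in `[a, (b * N%:R ^+ M)%R[) (total_density xi)%:E)%E.
  elim: M => [|M IH].
    rewrite big_geq//; apply: integral_ge0 => x _.
    by rewrite lee_fin total_density_ge0.
  rewrite big_nat_recr//=; apply: (@le_trans _ _
     (\int[mu]_(xi in `[a, (b * N%:R ^+ M)%R[) (total_density xi)%:E +
      \int[mu]_(xi in `[(a * N%:R ^+ M.+1)%R, (b * N%:R ^+ M.+1)%R[)
         (total_density xi)%:E)%E); first exact: leeD.
  have NM : 0 < N%:R ^+ M :> R by rewrite exprn_gt0.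
  have N2 : 2 <= N%:R :> R by rewrite ler_nat.
  (* Disjointness comes from a + 2 pi <= 2 a <= N a. *)
  have baM : b * N%:R ^+ M <= a * N%:R ^+ M.+1.
    rewrite exprS mulrA ler_pM2r//; apply: (@le_trans _ _ (a * 2)).
      by rewrite /b; lra.
    by rewrite ler_pM2l.
  rewrite -ge0_integral_setU//.
  - apply: ge0_subset_integral => //.
    + exact: measurableU.
    + exact: measurable_total_density.
    + by move=> x _; rewrite lee_fin total_density_ge0.
    + have aM : a <= a * N%:R ^+ M.+1.
        by rewrite ler_peMr ?(ltW a0)// exprn_ege1// ler1n.
      have bM : b * N%:R ^+ M <= b * N%:R ^+ M.+1.
        rewrite exprS mulrA ler_pM2r// ler_peMr// ?ler1n// /b.
        exact: addr_ge0 (ltW a0) (ltW p0).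
      move=> x /= [|]; rewrite !in_itv/= => /andP[x1 x2]; apply/andP; split => //.
      * exact: lt_le_trans x2 bM.
      * exact: le_trans aM x1.
  - exact: measurable_total_density.
  - by move=> x _; rewrite lee_fin total_density_ge0.
  - apply/disj_setPS => x [] /=; rewrite !in_itv/= => /andP[_ x1] /andP[x2 _].
    by have := lt_le_trans x1 (le_trans baM x2); rewrite ltxx.
apply: (@le_trans _ _ (\sum_(1 <= m < L) ((2 * pi)^-1%:E *
  \int[mu]_(xi in `[(a * N%:R ^+ m)%R, (b * N%:R ^+ m)%R[) (total_density xi)%:E))%E).
  by apply: lee_sum => m _; exact: fine_energy_le.
rewrite -ge0_sume_distrr; last first.
  by move=> m _; apply: integral_ge0 => x _; rewrite lee_fin total_density_ge0.
apply: lee_wpmul2l; first by rewrite lee_fin invr_ge0 ltW.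
case: L => [|L].
  rewrite big_geq//; apply: integral_ge0 => x _.
  by rewrite lee_fin total_density_ge0.
apply: le_trans (key L) _; apply: ge0_subset_integral => //.
- exact: measurable_total_density.
- by move=> x _; rewrite lee_fin total_density_ge0.
- by move=> x /=; rewrite !in_itv/= andbT => /andP[].
Qed.

(** By monotone convergence the integrals over []-oo, m[] increase to the finite total, so the rest
    is eventually below eps; m is also taken at least 2 pi. *)
Lemma total_density_tail (eps : R) : 0 < eps ->
  exists2 a : R, 2 * pi <= a &
    (\int[mu]_(xi in `[a, +oo[) (total_density xi)%:E <= eps%:E)%E.
Proof.
move=> eps0; pose F (m : nat) : set (measurableTypeR R) := `]-oo, m%:R[%classic.
have ndF : nondecreasing_seq F.
  apply/nondecreasing_seqP => m; rewrite subsetEset => x; rewrite /F /= !in_itv/=.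
  by move=> /lt_le_trans; apply; rewrite ler_nat.
have UF : \bigcup_m F m = setT.
  apply/seteqP; split => // x _; exists (Num.bound `|x|) => //; rewrite /F /= in_itv/=.
  exact: le_lt_trans (ler_norm x) (archi_boundP (normr_ge0 x)).
have td0 x : (0 <= (total_density x)%:E)%E by rewrite lee_fin total_density_ge0.
have cv : (\int[mu]_(x in F m) (total_density x)%:E @[m --> \oo] -->
    \int[mu]_(x in \bigcup_m F m) (total_density x)%:E)%E.
  apply: ge0_nondecreasing_set_cvg_integral => //.
    by move=> m; exact: measurable_itv.
  by move=> m; exact: measurable_total_density.
rewrite UF in cv.
have fI := integral_total_density_lty.
have I0 : (0 <= \int[mu]_xi (total_density xi)%:E)%E.
  by apply: integral_ge0 => x _; exact: td0.
set I := (\int[mu]_xi _)%E in cv fI I0.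
have If : I \is a fin_num by rewrite ge0_fin_numE.
have ltI : ((fine I - eps)%:E < I)%E.
  by rewrite -[ltRHS](fineK If) lte_fin ltrBlDr ltrDl.
have arith (J x y : \bar R) : (J = x + y -> (fine J - eps)%:E < x ->
    J \is a fin_num -> 0 <= x -> 0 <= y -> y <= eps%:E)%E.
  move: J x y => [J| |] [x| |] [y| |] //= [->].
  by rewrite lte_fin !lee_fin; lra.
near \oo => m.
have h1 : ((fine I - eps)%:E < \int[mu]_(x in F m) (total_density x)%:E)%E.
  by near: m; apply: (cv [set x | (fine I - eps)%:E < x]%E); exact: open_ereal_gt'.
exists m%:R; first by near: m; exact: nbhs_infty_ger.
have split_ : (I = \int[mu]_(x in F m) (total_density x)%:E +
    \int[mu]_(xi in `[m%:R, +oo[) (total_density xi)%:E)%E.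
  rewrite -ge0_integral_setU//.
  - congr (integral _ _ _); apply/seteqP; split => // x _ /=.
    by rewrite /F /= !in_itv/= andbT; case: (ltP x m%:R); [left|right].
  - exact: measurable_itv.
  - exact: measurable_total_density.
  - apply/disj_setPS => x [] /=; rewrite !in_itv/= andbT => x1 x2.
    by have := lt_le_trans x1 x2; rewrite ltxx.
have F0 : (0 <= \int[mu]_(x in F m) (total_density x)%:E)%E.
  by apply: integral_ge0 => x _; exact: td0.
have T0 : (0 <= \int[mu]_(xi in `[m%:R%R, +oo[) (total_density xi)%:E)%E.
  by apply: integral_ge0 => x _; exact: td0.
exact: arith split_ h1 If F0 T0.
Unshelve. all: by end_near. Qed.

End DimensionFunction.

(** * From the Calderon sums to the limsup *)

Section LimsupBound.
Variables (R : realType) (N n : nat) (sigma : {perm 'I_n}).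
Variable theta : 'I_n -> R.
Hypothesis hN : (2 <= N)%N.
Variables (r : nat) (Psi Psihat : 'I_r -> vec R n).
Hypothesis PsiF : forall p i, is_fourier (Psi p i) (Psihat p i).
Local Notation mu := (@lebesgue_measure R).
Local Notation coarse := (coarse_energy N sigma Psihat).
Local Notation D := (dimfun N sigma theta Psihat).
Implicit Types (i : 'I_n) (a : R).

Let N_gt0 : (0 < N)%N. Proof. exact: ltnW. Qed.
Let N0 : 0 < N%:R :> R. Proof. by rewrite ltr0n. Qed.
Let p0 := pi2_gt0 R.

Let mPsihat p i : cmeasurable (Psihat p i).
Proof. by case: (PsiF p i) => _ [[]]. Qed.

Let esqr_ge0 p i (x : R) : (0 <= (normc (Psihat p i x) ^+ 2)%:E)%E.
Proof. by rewrite lee_fin sqr_ge0. Qed.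

Lemma dimfun_ge0 xi : (0 <= D xi)%E.
Proof.
apply: sume_ge0 => p _; apply: nneseries_ge0 => m _ _; apply: sume_ge0 => i _.
by apply: esum_ge0 => k _.
Qed.

Lemma dimfun_ge_levels (alpha0 s : R) (M : nat) :
  (\sum_(p < r) \sum_(1 <= m < M) \sum_(i < n | theta i == alpha0)
     (normc (Psihat p ((sigma ^+ m)%g i) (N%:R ^+ m * s)) ^+ 2)%:E
   <= D (alpha0 + s)%R)%E.
Proof.
rewrite /dimfun; apply: lee_sum => p _.
pose F m := (\sum_(i < n) \esum_(k in [set: int])
    ((normc (Psihat p ((sigma ^+ m)%g i)
        (N%:R ^+ m * (alpha0 + s - theta i + 2 * k%:~R * pi))) ^+ 2)%:E))%E.
apply: (@le_trans _ _ (\sum_(1 <= m < M) F m)%E); last first.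
  apply: nneseries_lim_ge => m _ _; apply: sume_ge0 => i _.
  by apply: esum_ge0 => k _.
apply: lee_sum => m _; rewrite /F [leRHS](bigID (fun i => theta i == alpha0))/=.
apply: (@le_trans _ _ (\sum_(i < n | theta i == alpha0) \esum_(k in [set: int])
    ((normc (Psihat p ((sigma ^+ m)%g i)
        (N%:R ^+ m * (alpha0 + s - theta i + 2 * k%:~R * pi))) ^+ 2)%:E))%E).
  apply: lee_sum => i /eqP ->; apply: esum_ge; exists [set 0].
    by split => //; exact: finite_set1.
  rewrite fsbig_set1 le_eqVlt; apply/orP; left; apply/eqP.
  by congr ((normc (Psihat _ _ _) ^+ 2)%:E); rewrite mulr0z mulr0 mul0r; ring.
by apply: leeDl; apply: sume_ge0 => i _; apply: esum_ge0.
Qed.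

(* Along [s = xi / N^j] with the order of [sigma] dividing [j], the level
   [m = j - l] of [D (alpha0 + s)] is the term [l] of the Calderon sum. *)
Lemma calderon_le (alpha0 e c xi : R) (L : nat) : 0 < e -> 0 < xi ->
  (forall s, 0 < s < e -> (D (alpha0 + s)%R <= c%:E)%E) ->
  (\sum_(i < n | theta i == alpha0) \sum_(0 <= l < L) \sum_(p < r)
    (normc (Psihat p ((sigma^-1 ^+ l)%g i) (xi / N%:R ^+ l)) ^+ 2)%:E <= c%:E)%E.
Proof.
move=> e0 xi0 Dc.
(* Chosen so that j >= q exceeds xi / e, whence xi / N^j < e because j < N^j, and so that all the
   levels l < L fit below j. *)
pose q := (Num.bound (xi / e) + L)%N.
pose j := (#[sigma]%g * q)%N.
have qj : (q <= j)%N by rewrite leq_pmull// order_gt0.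
have Lj : (L <= j)%N by rewrite (leq_trans _ qj)// leq_addl.
have Nj : 0 < N%:R ^+ j :> R by rewrite exprn_gt0.
have sj : (sigma ^+ j)%g = 1%g by rewrite expgM expg_order expg1n.
have se : 0 < xi / N%:R ^+ j < e.
  rewrite divr_gt0//= ltr_pdivrMr// mulrC -ltr_pdivrMr//.
  apply: lt_le_trans (archi_boundP (divr_ge0 (ltW xi0) (ltW e0))) _.
  rewrite -natrX ler_nat (leq_trans _ (ltnW (ltn_expl j hN)))//.
  by rewrite (leq_trans _ qj)// leq_addr.
apply: le_trans (Dc _ se); apply: le_trans (dimfun_ge_levels _ _ j.+1).
(* Reversing the levels 1 <= m <= j through m = j - l gives 0 <= l < j, of which only l < L is
   kept. *)
rewrite exchange_big [leRHS]exchange_big/= big_add1/= [leRHS]big_nat_rev/= add0n.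
rewrite [leRHS](big_cat_nat (n := L) (p := j))//=.
rewrite -[leLHS]adde0; apply: leeD; last first.
  apply: sume_ge0 => m _; apply: sume_ge0 => p _; exact: sume_ge0.
rewrite big_nat_cond [leRHS]big_nat_cond; apply: lee_sum => l /andP[/andP[_ lL] _].
rewrite exchange_big; apply: lee_sum => p _; apply: lee_sum => i _.
have lj : (l < j)%N by exact: leq_trans lL Lj.
rewrite subnSK// le_eqVlt; apply/orP; left; apply/eqP.
congr ((normc (Psihat _ _ _) ^+ 2)%:E).
  have -> : (sigma ^+ (j - l) = sigma^-1 ^+ l)%g; last by [].
  apply: (mulIg (sigma ^+ l)%g).
  by rewrite -expgD subnK ?(ltnW lj)// sj expVgn mulVg.
have Nl m : N%:R ^+ m != 0 :> R by rewrite expf_neq0// lt0r_neq0.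
have Nj_split : N%:R ^+ j = N%:R ^+ (j - l) * N%:R ^+ l :> R.
  by rewrite -exprD subnK// ltnW.
by rewrite Nj_split invfM mulrCA mulVKf.
Qed.

(** The mean over [[a, a + 2 pi[] of the pointwise bound [calderon_le]. That bound holds at every xi
    > 0, so a may be as large as the fine levels require although D is controlled only near
    alpha0. *)
Lemma coarse_sum_le (alpha0 e c a : R) (L : nat) : 0 < e -> 0 < a ->
  (forall s, 0 < s < e -> (D (alpha0 + s)%R <= c%:E)%E) ->
  (\sum_(i < n | theta i == alpha0) \sum_(0 <= l < L) coarse a i l <= c%:E)%E.
Proof.
move=> e0 a0 Dc; set J := `[a, a + 2 * pi[%classic.
have mJ : measurable J by exact: measurable_itv.
have mh p i l : measurable_fun J (fun xi : R =>
    (normc (Psihat p ((sigma^-1 ^+ l)%g i) (xi / N%:R ^+ l)) ^+ 2)%:E).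
  apply: measurable_funTS.
  apply: (@measurable_esqr_normc _ (fun xi => Psihat p _ (xi / N%:R ^+ l))).
  rewrite (_ : (fun _ => _) = fun xi =>
    Psihat p ((sigma^-1 ^+ l)%g i) ((N%:R ^+ l)^-1 * xi + 0)).
    exact: cmeasurable_affine.
  by apply/funext => xi; rewrite addr0 mulrC.
have p1 : (0 <= ((2 * pi)^-1)%:E :> \bar R)%E by rewrite lee_fin invr_ge0 ltW.
have -> : (\sum_(i < n | theta i == alpha0) \sum_(0 <= l < L) coarse a i l =
  (2 * pi)^-1%:E * \int[mu]_(xi in J) (\sum_(i < n | theta i == alpha0)
   \sum_(0 <= l < L) \sum_(p < r)
    (normc (Psihat p ((sigma^-1 ^+ l)%g i) (xi / N%:R ^+ l)) ^+ 2)%:E))%E.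
  rewrite -big_filter; under eq_integral do rewrite -big_filter.
  rewrite ge0_integral_sum//; last 2 first.
  - by move=> i; apply: emeasurable_sum => l; apply: emeasurable_sum => p; exact: mh.
  - by move=> i x _; apply: sume_ge0 => l _; apply: sume_ge0.
  rewrite ge0_sume_distrr; last first.
    move=> i _; apply: integral_ge0 => x _.
    by apply: sume_ge0 => l _; apply: sume_ge0.
  apply: eq_bigr => i _; rewrite ge0_integral_sum//; last 2 first.
  - by move=> l; apply: emeasurable_sum => p; exact: mh.
  - by move=> l x _; apply: sume_ge0.
  rewrite ge0_sume_distrr; last first.
    by move=> l _; apply: integral_ge0 => x _; apply: sume_ge0.
  apply: eq_bigr => l _; rewrite ge0_integral_sum//; last by move=> p; exact: mh.
  rewrite ge0_sume_distrr// => p _; apply: integral_ge0 => x _; exact: esqr_ge0.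
have c0 : 0 <= c.
  rewrite -lee_fin; apply: le_trans (dimfun_ge0 _) (Dc (e / 2) _).
  by rewrite divr_gt0//= ltr_pdivrMr// ltr_pMr// ltr1n.
apply: (@le_trans _ _ ((2 * pi)^-1%:E * \int[mu]_(xi in J) c%:E)%E).
  apply: lee_wpmul2l => //; apply: ge0_le_integral => //.
  - by move=> x _; apply: sume_ge0 => i _; apply: sume_ge0 => l _; apply: sume_ge0.
  - under eq_fun do rewrite -big_filter.
    apply: emeasurable_sum => i; apply: emeasurable_sum => l.
    by apply: emeasurable_sum => p; exact: mh.
  - move=> x; rewrite /J /= in_itv/= => /andP[ax _].
    exact: calderon_le e0 (lt_le_trans a0 ax) Dc.
rewrite integral_cst//= lebesgue_measure_itv/= lte_fin ltrDl p0.
rewrite -EFinB -!EFinM lee_fin addrAC subrr add0r.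
rewrite [c * _]mulrC mulrA mulVf ?mul1r// lt0r_neq0//; exact: p0.
Qed.

Hypothesis tight : normalized_tight_frame (affine_system N sigma theta Psi).

Lemma card_le_dimfun_bound (alpha0 e c : R) : 0 < e ->
  (forall s, 0 < s < e -> (D (alpha0 + s)%R <= c%:E)%E) ->
  #|[pred i : 'I_n | theta i == alpha0]|%:R <= c.
Proof.
move=> e0 Dc; set K := #|_|%:R.
have K0 : 0 <= K by [].
apply/ler_addgt0Pl => d d0.
(* Summation over the K indices gives K (1 - eta) <= c + K eta, and this eta makes 2 K eta <= d; K +
   1 keeps the denominator positive when K = 0. *)
pose eta := d / (2 * (K + 1)).
have eta0 : 0 < eta by rewrite divr_gt0// mulr_gt0// ltr_wpDl.
(* The tail is taken below 2 pi eta because the fine energies carry the factor (2 pi)^-1. *)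
have [a ha tail] := total_density_tail PsiF (mulr_gt0 p0 eta0).
have a0 : 0 < a by exact: lt_le_trans ha.
have /fin_all_exists[L0 hL0] i := frame_lower_bound N_gt0 PsiF tight i a eta0.
pose L := (\sum_(i < n) L0 i)%N.
have hL i : ((1 - eta)%:E <= \sum_(0 <= l < L) coarse a i l + eta%:E)%E.
  apply: le_trans (hL0 i L _) _; first by rewrite /L (bigD1 i)//= leq_addr.
  apply: leeD => //; apply: le_trans (fine_energy_sum_le sigma hN PsiF i L ha) _.
  apply: (@le_trans _ _ ((2 * pi)^-1%:E * (2 * pi * eta)%:E)%E).
    by apply: lee_wpmul2l => //; rewrite lee_fin invr_ge0 ltW.
  by rewrite -EFinM lee_fin mulKf// lt0r_neq0//; exact: p0.
have sumE (z : R) : \sum_(i < n | theta i == alpha0) z = K * z.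
  by rewrite sumr_const -mulr_natl.
have : (\sum_(i < n | theta i == alpha0) (1 - eta)%:E <=
    \sum_(i < n | theta i == alpha0) (\sum_(0 <= l < L) coarse a i l + eta%:E))%E.
  exact: lee_sum.
rewrite big_split/= !sumEFin !sumE => /le_trans/(_ (leeD (coarse_sum_le L e0 a0 Dc) (lexx _))).
rewrite -EFinD lee_fin => H.
have Ke : 2 * (K * eta) <= d.
  rewrite /eta (_ : 2 * _ = d * (K / (K + 1))); last by field; rewrite lt0r_neq0// ltr_wpDl.
  by rewrite ler_piMr ?(ltW d0)// ler_pdivrMr ?ltr_wpDl// mul1r lerDl.
by move: H Ke; rewrite mulrBr mulr1; lra.
Qed.

(** The limsup is the infimum over e of the suprema of D on punctured balls, of which only the right
    half is used. A finite supremum is a bound c as above, an infinite one leaves nothing to prove,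
    and nonnegativity of D excludes -oo. *)
Lemma card_le_lime_sup_dimfun (alpha0 : R) :
  ((#|[pred i : 'I_n | theta i == alpha0]|%:R)%:E <= lime_sup D alpha0)%E.
Proof.
rewrite lime_supE; apply: le_ereal_inf_tmp => _ [e /= e0 <-].
have {}e0 : 0 < e by move: e0; rewrite in_itv/= andbT.
set S := ereal_sup _.
have DS s : 0 < s < e -> (D (alpha0 + s)%R <= S)%E.
  move=> /andP[s0 se]; apply: ereal_sup_ubound => /=; exists (alpha0 + s) => //.
  split; last by apply/eqP; rewrite -subr_eq0 addrAC subrr add0r gt_eqF.
  by rewrite /ball /= opprD addNKr normrN gtr0_norm.
case: S DS => [c| |] DS.
- by rewrite lee_fin; exact: card_le_dimfun_bound DS.
- by rewrite leey.
- have he : 0 < e / 2 < e by rewrite divr_gt0//= ltr_pdivrMr// ltr_pMr// ltr1n.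
  by have := le_trans (dimfun_ge0 _) (DS _ he).
Qed.

End LimsupBound.

Theorem corollary6p13 (R : realType) (N n : nat) (hN : (2 <= N)%N)
    (hn : (1 <= n)%N) (sigma : {perm 'I_n}) (theta : 'I_n -> R)
    (htheta : forall k : 'I_n, - pi <= theta k < pi)
    (hz : forall k : 'I_n, zpt theta k ^+ N = zpt theta (sigma k)) :
  (forall (r : nat) (Psi : 'I_r -> vec R n),
     semi_orthogonal_wavelet N sigma theta Psi ->
     forall Psihat : 'I_r -> vec R n,
       (forall p i, is_fourier (Psi p i) (Psihat p i)) ->
       forall alpha0 : R, - pi <= alpha0 < pi ->
         ((#|[pred i : 'I_n | theta i == alpha0]|%:R)%:E
            <= lime_sup (dimfun N sigma theta Psihat) alpha0)%E) /\
  ((exists i j : 'I_n, i <> j /\ theta i = theta j) ->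
   ~ exists (r : nat) (Psi : 'I_r -> vec R n),
       MRA_wavelet N sigma theta Psi).
Proof.
split; last exact: no_MRA_wavelet (ltnW hN).
move=> r Psi [_ tight _] Psihat PsiF alpha0 _.
exact: (card_le_lime_sup_dimfun hN PsiF tight alpha0).
Qed.
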